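(* A subvariety $X\subset G(k,n)$ is a (Grassmannian) projection variety if and only if $X$ is a rank variety.
   Context: Work over $\mathbb{C}$. Let $V$ be an $n$-dimensional vector space with fixed ordered basis $e_1,\dots,e_n$; $F_i=\langle e_1,\dots,e_i\rangle$ and $G_i=\langle e_n,\dots,e_{n-i+1}\rangle$. $G(k,n)$, $0<k<n$, is the Grassmannian of $k$-dimensional subspaces of $V$. Rank varieties: for $W=[e_i,e_j]:=\langle e_i,e_{i+1},\dots,e_j\rangle$ ($i\le j$) put $l(W)=i$, $r(W)=j$. A rank set for $G(k,n)$ is a set $M=\{W_1,\dots,W_k\}$ of $k$ such subspaces with $l(W_i)\ne l(W_j)$ and $r(W_i)\neq r(W_j)$ for $i\ne j$. The rank variety $X(M)\subset G(k,n)$ is the Zariski closure of the set of $k$-planes having a basis $b_1,\dots,b_k$ with $b_i\in W_i$. Projection varieties: for $0=k_0<k_1<\dots<k_m<n$, $Fl(k_1,\dots,k_m;n)$ parametrizes flags $V_1\subset\dots\subset V_m\subset V$ with $\dim V_i=k_i$. Schubert varieties are indexed by lists $u=(u_1,\dots,u_{k_m})$ of distinct integers in $\{1,\dots,n\}$ with $u_j<u_{j+1}$ unless $j\in\{k_1,\dots,k_m\}$; the color of $u_i$ is $c_i=l$ if $k_{l-1}<i\le k_l$. For a complete flag $F_\bullet$, $$X_u(F_\bullet)=\{(V_1,\dots,V_m)\mid \dim(V_j\cap F_{u_i})\ge \#\{l : u_l\le u_i,\ c_l\le j\}\ \text{for all } i,j\}.$$ The Richardson variety is $R(u,v)=X_u(F_\bullet)\cap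 X_v(G_\bullet)$ (non-empty). A (Grassmannian) projection variety in $G(k,n)$ is the image $\pi(R(u,v))$, with reduced structure, of a Richardson variety $R(u,v)$ in some $Fl(k_1,\dots,k_m;n)$ with $k_m=k$, under $\pi(V_1,\dots,V_m)=V_m$. *)

(* Defs.v *)
From mathcomp Require Export all_boot all_order all_algebra.
From mathcomp Require Export classical_sets reals.
From mathcomp Require Export mpoly.
From mathcomp Require Export complex.

Set Implicit Arguments.
Unset Strict Implicit.
Unset Printing Implicit Defensive.

Import GRing.Theory.
Local Open Scope ring_scope.
Local Open Scope classical_set_scope.

Section Grassmannian.
Variables (K : fieldType) (n : nat) (V : vectType K) (e : n.-tuple V).
Implicit Types (W : {vspace V}) (k : nat).

(* G(k,n), as a set of closed points; varieties are identified with their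
   sets of closed points. *)
Definition grass k : set {vspace V} := [set W | \dim W = k].

Definition ksubset k := {I : {set 'I_n} | #|I| == k}.

(* The k x k minor, on the columns in I taken in increasing order, of the
   matrix of the coordinates in e of the basis vbasis W of W. *)
Definition plucker k W (I : ksubset k) : K :=
  \det (\matrix_(i < k, j < k)
     coord e (enum_val (cast_ord (esym (eqP (valP I))) j)) (vbasis W)`_i).

Definition zariski_closed k (Z : set {vspace V}) : Prop :=
  exists S : set {mpoly K[#|{: ksubset k}|]},
    (forall p, S p -> exists d, p \is d.-homog) /\
    Z = grass k `&`
        [set W | forall p, S p -> p.@[fun a => plucker W (enum_val a)] = 0].

Definition zariski_closure k (A : set {vspace V}) : set {vspace V} :=
  smallest (zariski_closed k) A.

(* [e_i, e_j], for 1 <= i <= j <= n *)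
Definition span_interval (i j : nat) : {vspace V} := <<drop i.-1 (take j e)>>%VS.

(* A rank set lists the pairs (l(W), r(W)), with values in 1..n; its order is
   immaterial. *)
Definition rank_set k (M : seq (nat * nat)) : Prop :=
  [/\ size M = k,
      all (fun p => (1 <= p.1 <= p.2)%N && (p.2 <= n)%N) M,
      uniq [seq p.1 | p <- M] & uniq [seq p.2 | p <- M]].

Definition rank_cell (M : seq (nat * nat)) : set {vspace V} :=
  [set W | exists b : seq V,
     basis_of W b /\ all2 (fun x p => x \in span_interval p.1 p.2) b M].

Definition rank_variety k (X : set {vspace V}) : Prop :=
  exists M, rank_set k M /\ X = zariski_closure k (rank_cell M).

Definition flagF (i : nat) : {vspace V} := <<take i e>>%VS.
Definition flagG (i : nat) : {vspace V} := <<take i (rev e)>>%VS.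

(* Below ks = [:: k_1; ..; k_m], a partial flag is the sequence of its m
   subspaces, and u = [:: u_1; ..; u_(k_m)] has values in 1..n.  Positions in
   these sequences and colors are counted from 0. *)
Definition flag_dims k (ks : seq nat) : Prop :=
  sorted ltn (0%N :: ks) /\ last 0%N ks = k.

Definition partial_flag (ks : seq nat) : set (seq {vspace V}) :=
  [set fl | sorted (fun U W => (U <= W)%VS) fl /\
            [seq \dim W | W : {vspace V} <- fl] = ks].

Definition schubert_index (ks u : seq nat) : Prop :=
  [/\ size u = last 0%N ks, uniq u, all (fun a => 1 <= a <= n)%N u &
      forall j, (j.+1 < size u)%N -> j.+1 \notin ks ->
        (nth 0%N u j < nth 0%N u j.+1)%N].

(* The least l with i < k_(l+1), i.e. k_l <= i < k_(l+1). *)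
Definition color (ks : seq nat) (i : nat) : nat := find (fun a => i < a)%N ks.

Definition schubert (ks u : seq nat) (E : nat -> {vspace V}) :
    set (seq {vspace V}) :=
  [set fl | partial_flag ks fl /\
     forall i j, (i < size u)%N -> (j < size ks)%N ->
       (#|[pred l : 'I_(size u) | (nth 0 u l <= nth 0 u i)
                                  && (color ks l <= j)]|
          <= \dim (nth 0%VS fl j :&: E (nth 0 u i)))%N].

Definition richardson (ks u v : seq nat) : set (seq {vspace V}) :=
  schubert ks u flagF `&` schubert ks v flagG.

Definition projection_variety k (X : set {vspace V}) : Prop :=
  exists ks u v : seq nat,
    [/\ flag_dims k ks, schubert_index ks u, schubert_index ks v,
        richardson ks u v !=set0 &
        X = last 0%VS @` richardson ks u v].

End Grassmannian.

(* Main.v *)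
Require Import Defs.
From mathcomp Require Import zify fintype finset.

Set Implicit Arguments.
Unset Strict Implicit.
Unset Printing Implicit Defensive.
Import Order.TTheory GRing.Theory Num.Theory.

(** Both kinds of varieties are the sets of planes [W] of dimension [k] with
  [dim (W :&: [e_a, e_b]) >= #{i | W_i is contained in [e_a, e_b]}]
for all intervals, where [W_i], of ends [l_i] and [r_i], runs over a rank set.
Write [u i = r_i] and [v i = n + 1 - l_i], so that [W_i] is the intersection of
the [u i]-th space of the flag [F] and the [v i]-th space of the flag [G], and
list the rank set by increasing [u].

Projections.  A partial flag refines to a chain [C 0 < C 1 < ... < C k = W]
(image_flagged), on which the Schubert conditions are lower bounds for
[dim (C j :&: F b)] and [dim (C j :&: G c)].  Where a word descends, its
condition on [C j] follows from those on the two neighbours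
(schubert_at_descent), while [C j] can always be chosen again so as to satisfy
one condition (insert_step).  So at a descent of [u] one may first make [v]
descend too, after which nothing is asked of [C j] and the two entries of [u]
may be exchanged (flagged_swap_descent).  Bubble sort thus replaces any
Richardson variety by one with increasing [u] and the same projection
(flagged_blocks, flagged_increasing).  If [u] increases, a flag with the
Schubert conditions gives the dimensions above (flagged_incident); conversely
the flag is peeled off from the top, by hyperplanes chosen by a dimension count
(incident_hyperplane).

Closures.  The conditions on dimensions are linear equations between Pluecker
coordinates (dim_cap_plucker), so they pass from the rank cell to its closure.
Conversely, given [W] with these dimensions, take its flag and a basis adapted
to this flag and to [G]: the basis puts [W] in the cell of [(u, g)] for a word
[g] that dominates [v] in Bruhat order.  Each step from [g] towards [v] either
enlarges an interval, hence the cell, or replaces two nested intervals by the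
two overlapping ones with the same ends; then the old cell lies in the closure
of the new one, by an explicit degeneration along a line (cell_exchange,
zariski_closed_limit).  So [W] lies in the closure of the rank cell
(in_cell_limit, closure_rank_cell). *)

(** * Counting the entries of a word below a bound *)

Definition below (w : nat -> nat) (j b : nat) : nat := \sum_(i < j) (w i <= b).

Lemma belowS w j b : below w j.+1 b = below w j b + (w j <= b).
Proof. by rewrite /below big_ord_recr. Qed.

Lemma below0 w b : below w 0 b = 0.
Proof. by rewrite /below big_ord0. Qed.

Lemma below_all w j b : (forall i, i < j -> w i <= b) -> below w j b = j.
Proof.
elim: j => [|j IHj] wb; first by rewrite below0.
by rewrite belowS wb // IHj ?addn1 // => i ij; apply/wb/ltnW.
Qed.

Lemma below_none w j b : (forall i, i < j -> b < w i) -> below w j b = 0.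
Proof.
elim: j => [|j IHj] wb; first by rewrite below0.
by rewrite belowS leqNgt wb //= IHj // => i ij; apply/wb/ltnW.
Qed.

Lemma eq_below w w' j b :
  (forall i, i < j -> w i = w' i) -> below w j b = below w' j b.
Proof. by move=> ww'; apply: eq_bigr => i _; rewrite ww'. Qed.

Definition exchange (i j : nat) (w : nat -> nat) (s : nat) : nat :=
  if s == i then w j else if s == j then w i else w s.

Local Notation exchange_next i := (exchange i i.+1).

Lemma sum_exchange (h : nat -> nat -> nat) i j w l : i < j ->
  \sum_(s < l) h s (exchange i j w s)
    + ((i < l) * h i (w i) + (j < l) * h j (w j))
  = \sum_(s < l) h s (w s) + ((i < l) * h i (w j) + (j < l) * h j (w i)).
Proof.
move=> ij; elim: l => [|l IHl]; first by rewrite !big_ord0.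
rewrite !big_ord_recr /= {2}/exchange; move: IHl.
move: (\sum_(s < l) _) (\sum_(s < l) _) => s1 s2.
have -> : (i < l.+1) = (i < l) + (l == i) :> nat by lia.
have -> : (j < l.+1) = (j < l) + (l == j) :> nat by lia.
by case: (ltnP i l) => il; case: (ltnP j l) => jl; case: (eqVneq l i) => [? | li];
  case: (eqVneq l j) => [? | lj]; subst; rewrite ?mul1n ?mul0n /=; lia.
Qed.

Lemma below_exchange i j w l b : i < j ->
  below (exchange i j w) l b + (i < l <= j) * (w i <= b)
  = below w l b + (i < l <= j) * (w j <= b).
Proof.
move=> ij; have := sum_exchange (fun _ x => (x <= b) : nat) w l ij.
by rewrite /below; case: (ltnP i l) => il; case: (ltnP j l) => jl /=; lia.
Qed.

Lemma below_swap j w l b : l != j.+1 -> below (exchange_next j w) l b = below w l b.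
Proof.
move=> lj; have := below_exchange w l b (ltnSn j).
by rewrite (_ : (j < l <= j.+1) = false) ?addn0 //; lia.
Qed.

(** Bubble sort: exchanging neighbours that are in the wrong order lowers the
weighted sum of the entries, for suitable weights [f]. *)
Lemma swap_sort k (f : nat -> nat) (bad : pred nat) (r : rel nat)
    (Q : (nat -> nat) -> Prop) (w : nat -> nat) :
  (forall i x y, i.+1 < k -> r x y ->
     f i * y + f i.+1 * x < f i * x + f i.+1 * y) ->
  (forall i w, i.+1 < k -> bad i -> r (w i) (w i.+1) -> Q w -> Q (exchange_next i w)) ->
  Q w ->
  exists2 w', Q w' & forall i, i.+1 < k -> bad i -> ~~ r (w' i) (w' i.+1).
Proof.
move=> fr Qswap.
have [m] := ubnP (\sum_(i < k) f i * w i); elim: m w => // m IHm w lt_m Qw.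
case: (boolP [exists i : 'I_k, [&& i.+1 < k, bad i & r (w i) (w i.+1)]]).
  move=> /existsP[[i ik'] /= /and3P[ik bad_i rw]].
  apply: (IHm (exchange_next i w)); last exact: Qswap.
  have := sum_exchange (fun s x => f s * x) w k (ltnSn i).
  rewrite ik ik' !mul1n; have := fr i _ _ ik rw; lia.
move=> /existsPn nbad; exists w => // i ik bad_i; apply/negP => rw.
by have := nbad (Ordinal (ltnW ik)); rewrite /= ik bad_i rw.
Qed.

(** * Flags with incidence conditions *)

Section Filtrations.
Variables (K : fieldType) (V : vectType K).
Implicit Types (A D U W : {vspace V}) (C E F G : nat -> {vspace V}).

Definition exhaustive n E : Prop :=
  [/\ E 0 = 0%VS, forall b, n <= b -> E b = fullv &
      forall a b, a <= b -> (E a <= E b)%VS].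

Lemma dim_addv_line A (x : V) : x \notin A -> \dim (A + <[x]>) = (\dim A).+1.
Proof.
move=> xA; have x0 : x != 0%R by apply: contraNneq xA => ->; rewrite mem0v.
rewrite dimv_disjoint_sum ?dim_vline ?x0 ?addn1 //; apply/eqP.
rewrite -subv0; apply/subvP => y; rewrite memv_cap => /andP[yA /vlineP[c yc]].
rewrite memv0 yc scaler_eq0; case: (eqVneq c 0%R) => //= c0.
by case/negP: xA; rewrite -(scalerK c0 x) -yc memvZ.
Qed.

(** Intersecting with [U] does not increase codimensions. *)
Lemma dim_capv_sub A D U : (A <= D)%VS ->
  \dim (D :&: U) + \dim A <= \dim (A :&: U) + \dim D.
Proof.
move=> AD; have := dimv_sum_cap (D :&: U) A.
have -> : (D :&: U :&: A = A :&: U)%VS.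
  by rewrite -capvA capvC -capvA (capv_idPl AD) capvC.
by move=> <-; rewrite addnC leq_add2l dimvS // subv_add AD capvSl.
Qed.

(** Between [A] and a [D] of two dimensions more there is room for one
incidence condition: add to [A] a vector of the first step of [E] in which
[D] has something outside [A]. *)
Lemma insert_step n E (f0 f1 f2 : nat -> nat) A D :
  exhaustive n E -> (A <= D)%VS -> \dim D = (\dim A).+2 ->
  (forall b, f1 b <= (f0 b).+1) -> (forall b, f1 b <= f2 b) ->
  (forall b, f0 b <= \dim (A :&: E b)) ->
  (forall b, f2 b <= \dim (D :&: E b)) ->
  exists C : {vspace V}, [/\ (A <= C)%VS, (C <= D)%VS, \dim C = (\dim A).+1 &
                forall b, f1 b <= \dim (C :&: E b)].
Proof.
move=> [_ En Emono] AD dimD f10 f12 f0A f2D.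
have exB : exists b, ~~ (D :&: E b <= A)%VS.
  exists n; rewrite En // capvf; apply/negP => /dimvS; rewrite dimD; lia.
case: (ex_minnP exB) => B /subvPn[x]; rewrite memv_cap => /andP[xD xB] xA minB.
exists (A + <[x]>)%VS; split; rewrite ?addvSl ?dim_addv_line //.
  by rewrite subv_add AD -memvE.
move=> b; case: (leqP B b) => [Bb | bB].
  apply: leq_trans (f10 b) _; apply: leq_ltn_trans (f0A b) _.
  rewrite -(@dim_addv_line _ x); last by rewrite memv_cap negb_and xA.
  apply: dimvS; rewrite subv_cap addvS ?capvSl //=.
  by rewrite subv_add capvSr -memvE (subvP (Emono _ _ Bb)).
have DbA : (D :&: E b <= A)%VS.
  by apply: contraTT bB => /minB; rewrite -leqNgt.
apply: leq_trans (f12 b) _; apply: leq_trans (f2D b) _.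
by apply: dimvS; rewrite subv_cap capvSr (subv_trans DbA) ?addvSl.
Qed.

Definition chain k (C : nat -> {vspace V}) : Prop :=
  (forall j, j <= k -> \dim (C j) = j) /\ (forall j, j < k -> (C j <= C j.+1)%VS).

Lemma chain_mono k C i j : chain k C -> i <= j -> j <= k -> (C i <= C j)%VS.
Proof.
move=> [_ sub]; elim: j => [|j IHj]; first by rewrite leqn0 => /eqP->.
rewrite leq_eqVlt => /predU1P[-> // | ij] jk.
by apply: subv_trans (IHj _ (ltnW jk)) (sub _ jk).
Qed.

Definition schubert_at E w j A : Prop := forall b, below w j b <= \dim (A :&: E b).

(** Chains have a space in every dimension; a partial flag is a chain of which
only the levels in [L] are looked at. *)
Definition flagged (L : pred nat) k F u G v W : Prop :=
  exists C, [/\ chain k C, C k = W &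
    forall j, j <= k -> L j -> schubert_at F u j (C j) /\ schubert_at G v j (C j)].

Lemma flaggedC L k F u G v W : flagged L k F u G v W -> flagged L k G v F u W.
Proof. by case=> C [chC Ck H]; exists C; split=> // j jk /(H j jk)[]. Qed.

Lemma flagged_sub (L L' : pred nat) k F u G v W :
  (forall j, L' j -> L j) -> flagged L k F u G v W -> flagged L' k F u G v W.
Proof. by move=> sL [C [chC Ck H]]; exists C; split=> // j jk /sL/(H j jk). Qed.

(** If [b < w j], the bound is the one for [A]; otherwise [w j.+1 <= b] as well,
and it is one less than the bound for [D]. *)
Lemma schubert_at_descent E w j A (C : {vspace V}) D :
  w j.+1 < w j -> (A <= C)%VS -> (C <= D)%VS -> \dim D = (\dim C).+1 ->
  schubert_at E w j A -> schubert_at E w j.+2 D -> schubert_at E w j.+1 C.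
Proof.
move=> desc AC CD dimD wA wD b; case: (leqP (w j) b) => wjb.
  have := dim_capv_sub (E b) CD; have := wD b.
  by rewrite !belowS dimD; lia.
rewrite belowS (leqNgt (w j)) wjb addn0; apply: leq_trans (wA b) _.
by apply/dimvS/capvS.
Qed.

(** At a descent of [u] the condition of [u] is automatic, so the space at that
level can be chosen again to suit [v]. *)
Lemma flagged_drop n k F u G v W j :
  exhaustive n G -> j.+1 < k -> u j.+1 < u j ->
  flagged (predC1 j.+1) k F u G v W -> flagged predT k F u G v W.
Proof.
move=> exG jk desc [C [chC Ck HC]]; have [dimC subC] := chC.
have [uj vj] := HC j (ltnW (ltnW jk)) ltac:(rewrite /=; lia).
have [uj2 vj2] := HC j.+2 jk ltac:(rewrite /=; lia).
have CjD := chain_mono chC (leqW (leqnSn j)) jk.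
have [|b|b|D [AD DE dimD vD]] := insert_step (f1 := below v j.+1) exG CjD _ _ _ vj vj2.
- by rewrite !dimC //; lia.
- by rewrite belowS -addn1 leq_add2l leq_b1.
- by rewrite [leqRHS]belowS leq_addr.
exists (fun i => if i == j.+1 then D else C i); split; last first.
- move=> i ik _; case: eqP => [-> | /eqP ij]; last exact: HC.
  split=> //; apply: schubert_at_descent desc AD DE _ uj uj2.
  by rewrite dimD !dimC //; lia.
- by rewrite ifN ?Ck //; lia.
split=> i ik.
  by case: eqP => [-> | _]; rewrite ?dimD dimC //; lia.
case: (eqVneq i j.+1) => [-> | ij]; first by rewrite ifN //; lia.
by case: (eqVneq i.+1 j.+1) => [[->] // | ij']; apply: subC.
Qed.

Lemma flagged_swap L k F u G v W j : ~~ L j.+1 ->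
  flagged L k F (exchange_next j u) G v W <-> flagged L k F u G v W.
Proof.
move=> Lj; split=> [] [C [chC Ck HC]]; exists C; split=> // i ik Li;
  have [ui vi] := HC i ik Li; split=> // b; have := ui b;
  by rewrite below_swap //; apply: contraNneq Lj => <-.
Qed.

(** If [v] ascends, the flags for [(u, v)] and for [(u, exchange_next j v)] have
the same top space, by the choice in [flagged_drop]; once both words descend the
level [j.+1] is free, and there [u] can be exchanged as well. *)
Lemma flagged_swap_descent n k F u G v W j :
  exhaustive n F -> exhaustive n G -> j.+1 < k -> u j.+1 < u j ->
  v j != v j.+1 ->
  flagged predT k F u G v W <->
  flagged predT k F (exchange_next j u) G (if v j.+1 < v j then v else exchange_next j v) W.
Proof.
move=> exF exG jk desc vj; set v' := if _ then _ else _.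
have desc' : v' j.+1 < v' j.
  by rewrite /v'; case: (ltnP (v j.+1)) => // vv; rewrite /exchange !eqxx ifN; lia.
have drop : flagged predT k F u G v W <-> flagged (predC1 j.+1) k F u G v W.
  split; [exact: flagged_sub | exact: flagged_drop exG jk desc].
have drop' : flagged predT k F (exchange_next j u) G v' W <->
             flagged (predC1 j.+1) k F (exchange_next j u) G v' W.
  split; first exact: flagged_sub.
  by move=> /flaggedC /(flagged_drop exF jk desc') /flaggedC.
have free_level : ~~ predC1 j.+1 j.+1 by rewrite /= eqxx.
rewrite drop drop' flagged_swap // /v'; case: ifP => // _.
split; first by move=> /flaggedC H; apply/flaggedC/(flagged_swap _ _ _ _ _ _ free_level).
by move=> /flaggedC /(flagged_swap _ _ _ _ _ _ free_level) /flaggedC.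
Qed.

Definition good_word n k (w : nat -> nat) : Prop :=
  (forall i, i < k -> 0 < w i <= n) /\
  (forall i j, i < k -> j < k -> w i = w j -> i = j).

Lemma good_word_swap n k w j : j.+1 < k -> good_word n k w -> good_word n k (exchange_next j w).
Proof.
move=> jk [rng inj]; split=> [i ik | i i' ik ik']; rewrite /exchange.
  by do 2?case: ifP => _; apply: rng; lia.
by do 4?case: eqP => ?; subst; move=> //= /inj; lia.
Qed.

(** Weights that decrease with the position make bubble sort end in increasing
order; the word [v] is carried along. *)
Lemma flagged_increasing n k F u G v :
  exhaustive n F -> exhaustive n G -> good_word n k u -> good_word n k v ->
  exists u' v', [/\ good_word n k u', good_word n k v',
    (forall i, i.+1 < k -> u' i < u' i.+1) &
    forall W, flagged predT k F u G v W <-> flagged predT k F u' G v' W].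
Proof.
move=> exF exG gu gv.
pose Q u' := good_word n k u' /\ exists2 v', good_word n k v' &
  forall W, flagged predT k F u G v W <-> flagged predT k F u' G v' W.
have [||| u' [gu' [v' gv' uv']] inc] :=
  @swap_sort k (fun i => k - i) xpredT (fun x y => y < x) Q u.
- by move=> i x y ik yx; nia.
- move=> i u1 ik _ desc [gu1 [v1 gv1 uv1]]; split; first exact: good_word_swap.
  exists (if v1 i.+1 < v1 i then v1 else exchange_next i v1) => [|W].
    by case: ifP => // _; apply: good_word_swap.
  rewrite uv1; apply: (flagged_swap_descent _ exF exG ik desc).
  by apply/eqP => /(gv1.2 _ _ (ltnW ik) ik); lia.
- by split=> //; exists v.
exists u', v'; split=> // i ik; have := inc i ik isT; rewrite -leqNgt leq_eqVlt.
by case/orP => // /eqP /(gu'.2 _ _ (ltnW ik) ik); lia.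
Qed.
End Filtrations.

Section Blocks.
Variables (K : fieldType) (V : vectType K).
Implicit Types (A D U W : {vspace V}) (C E F G : nat -> {vspace V}).

(** If [w] descends across every level outside [L], its conditions at the
levels in [L] imply all of them: above a level where the next entry is at most
[b] the count grows as fast as it can, below it the count is constant. *)
Lemma schubert_at_blocks (L : pred nat) k E w C :
  chain k C -> L k ->
  (forall i, i.+1 < k -> ~~ L i.+1 -> w i.+1 < w i) ->
  (forall j, j <= k -> L j -> schubert_at E w j (C j)) ->
  forall j, j <= k -> schubert_at E w j (C j).
Proof.
move=> chC Lk desc wL; have [dimC subC] := chC.
have up b m j : j + m = k -> L j || (w j <= b) ->
    below w j b <= \dim (C j :&: E b).
  elim: m j => [|m IHm] j jm; first by rewrite addn0 in jm; subst j => _; apply: wL.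
  case Lj: (L j) => /= wj; first by apply: wL => //; lia.
  have jk : j < k by lia.
  have Lwj1 : L j.+1 || (w j.+1 <= b).
    case: (boolP (L j.+1)) => //= Lj1; apply: leq_trans wj; apply/ltnW/desc => //.
    by rewrite ltn_neqAle jk andbT; apply: contraNneq Lj1 => ->.
  have := IHm j.+1 ltac:(lia) Lwj1; have := dim_capv_sub (E b) (subC j jk).
  by rewrite belowS wj !dimC //; lia.
elim=> [|j IHj] jk b; first by rewrite below0.
case: (boolP (L j.+1)) => Lj; first exact: wL.
have j1k : j.+1 < k.
  by rewrite ltn_neqAle jk andbT; apply: contraNneq Lj => ->.
case: (leqP (w j.+1) b) => wj; first by apply: (up b (k - j.+1)); [lia | rewrite wj orbT].
have bwj : b < w j by apply: ltn_trans wj (desc _ j1k Lj).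
rewrite belowS (leqNgt (w j)) bwj addn0; apply: leq_trans (IHj (ltnW jk) b) _.
by apply/dimvS/capvS => //; apply: subC.
Qed.

(** Permuting a word between two levels of [L] does not affect the conditions at
the levels of [L], so the blocks may be put in decreasing order. *)
Lemma flagged_blocks (L : pred nat) n k F u G v :
  L k -> good_word n k u -> good_word n k v ->
  exists u' v', [/\ good_word n k u', good_word n k v' &
    forall W, flagged L k F u G v W <-> flagged predT k F u' G v' W].
Proof.
move=> Lk gu gv.
have sortL w : good_word n k w ->
    exists w', [/\ good_word n k w',
      forall i, i.+1 < k -> ~~ L i.+1 -> w' i.+1 < w' i &
      forall E j b, L j -> below w' j b = below w j b].
  move=> gw; pose Q w' := good_word n k w' /\
    forall j b, L j -> below w' j b = below w j b.
  have [||| w' [gw' ww'] desc] :=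
    @swap_sort k id (fun i => ~~ L i.+1) (fun x y => x < y) Q w.
  - by move=> i x y _ xy; nia.
  - move=> i w1 ik Li _ [gw1 ww1]; split; first exact: good_word_swap.
    move=> j b Lj; rewrite below_swap ?ww1 //.
    by apply: contraNneq Li => <-.
  - by split.
  exists w'; split=> // i ik Li; have := desc i ik Li; rewrite -leqNgt leq_eqVlt.
  by case/orP => // /eqP /(gw'.2 _ _ ik (ltnW ik)); lia.
have [u' [gu' descu uu']] := sortL u gu.
have [v' [gv' descv vv']] := sortL v gv.
exists u', v'; split=> // W; split=> [] [C [chC Ck HC]]; exists C; split=> //.
  move=> j jk _; split; apply: (schubert_at_blocks chC Lk) => // i ik Li b.
    by rewrite uu' //; apply: (HC i ik Li).1.
  by rewrite vv' //; apply: (HC i ik Li).2.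
move=> j jk Lj; have [uj vj] := HC j jk isT.
by split=> b; rewrite -?uu' -?vv'.
Qed.

End Blocks.

(** * Flags and intersections with intervals *)

Section Intervals.
Variables (K : fieldType) (V : vectType K).
Implicit Types (A D U W : {vspace V}) (C E F G : nat -> {vspace V}).

Definition below2 (u v : nat -> nat) (k b c : nat) : nat :=
  \sum_(i < k) ((u i <= b) && (v i <= c)).

Lemma below2S u v k b c :
  below2 u v k.+1 b c = below2 u v k b c + ((u k <= b) && (v k <= c)).
Proof. by rewrite /below2 big_ord_recr. Qed.

Lemma below2_below u v k b c : (forall i, i < k -> v i <= c) ->
  below2 u v k b c = below u k b.
Proof. by move=> vc; apply: eq_bigr => i _; rewrite vc ?andbT. Qed.

Lemma below2C u v k b c : below2 u v k b c = below2 v u k c b.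
Proof. by apply: eq_bigr => i _; rewrite andbC. Qed.

Lemma below_le w j b : below w j b <= j.
Proof.
elim: j => [|j IHj]; first by rewrite below0.
by rewrite belowS -addn1 leq_add ?leq_b1.
Qed.

Lemma below2_incl_excl u v k b b1 c : b <= b1 ->
  below2 u v k b1 c + below u k b <= below u k b1 + below2 u v k b c.
Proof.
move=> bb1; elim: k => [|k IHk]; first by rewrite /below2 /below !big_ord0.
by rewrite !below2S !belowS; move: IHk; case: (v k <= c); lia.
Qed.

(** The dimensions that are forced by [k] independent vectors, one in each
[F (u i) :&: G (v i)]. *)
Definition incident k F u G v W : Prop :=
  forall b c, below2 u v k b c <= \dim (W :&: (F b :&: G c)).

Lemma hyperplane_containing U W : (U <= W)%VS -> U != W ->
  exists W', [/\ (U <= W')%VS, (W' <= W)%VS & (\dim W').+1 = \dim W].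
Proof.
move=> UW neUW.
have /subvPn[x xW xU] : ~~ (W <= U)%VS.
  by apply: contra neUW => WU; rewrite eqEsubv UW.
set U' := (U + <[x]>)%VS; have dimU' : \dim U' = (\dim U).+1 by apply: dim_addv_line.
have U'W : (U' <= W)%VS by rewrite subv_add UW -memvE.
exists (U + (W :\: U'))%VS; split; first exact: addvSl.
  by rewrite subv_add UW diffvSl.
have full : (U + (W :\: U') + <[x]> = W)%VS.
  by rewrite -addvA (addvC (W :\: U')%VS) addvA -/U' addvC addv_diff; apply/addv_idPl.
apply/eqP; rewrite eqn_leq; apply/andP; split; last first.
  rewrite -{1}full; apply: leq_trans (dimv_add_leqif _ _).1 _.
  by rewrite dim_vline; case: (x != 0%R); lia.
have := (dimv_add_leqif U (W :\: U')).1.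
by have := dimv_cap_compl W U'; rewrite (capv_idPr U'W) dimU' /diffv; lia.
Qed.

(** Let [b'] be the last [b] where the condition on [W :&: F b] is tight, and
[c'] the last [c] where the one on [W :&: (F b1 :&: G c)] is tight for some
[b1 > b'].  Every condition with [b > b'] and [c > c'] has room for a loss of
one dimension, so it suffices that the hyperplane contain [W :&: F b'] and
[W :&: G c'].  Their sum is not [W], since by inclusion and exclusion it misses
part of [W :&: F b1], where the condition is not tight. *)
Lemma incident_hyperplane n k F u G v W :
  exhaustive n F -> exhaustive n G ->
  (forall i, i < k -> u i <= n) -> (forall i, i < k -> v i <= n) ->
  \dim W = k.+1 -> incident k F u G v W ->
  exists W', [/\ (W' <= W)%VS, \dim W' = k & incident k F u G v W'].
Proof.
move=> [F0 Fn Fmono] [G0 Gn Gmono] un vn dimW incW.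
pose P b := \dim (W :&: F b) <= below u k b.
have Pn b : P b -> b < n.
  rewrite /P ltnNge; apply: contraL => nb; rewrite Fn // capvf dimW -ltnNge.
  by rewrite ltnS below_le.
have exP : exists b, P b by exists 0; rewrite /P F0 capv0 dimv0.
case: (ex_maxnP exP (fun b Pb => ltnW (Pn b Pb))) => b' Pb' maxb'.
pose P' c := [exists b1 : 'I_n.+1,
  (b' < b1) && (\dim (W :&: (F b1 :&: G c)) <= below2 u v k b1 c)].
have P'n c : P' c -> c < n.
  move=> /existsP[b1 /andP[b'b1]]; rewrite ltnNge; apply: contraL => nc.
  rewrite Gn // capvf below2_below => [|i ik]; last exact: leq_trans (vn i ik) nc.
  by apply: contraL b'b1 => /maxb'; rewrite -leqNgt.
have exP' : exists c, P' c.
  exists 0; apply/existsP; exists ord_max.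
  by rewrite /= (Pn b') // G0 !capv0 dimv0.
case: (ex_maxnP exP' (fun c Pc => ltnW (P'n c Pc))) => c' P'c' maxc'.
(* The count is constant from [n] on, which reduces to [b <= n]. *)
have room b c : b' < b -> c' < c ->
    below2 u v k b c < \dim (W :&: (F b :&: G c)).
  move=> b'b c'c; wlog bn : b b'b / b <= n => [IH|].
    case: (leqP b n) => [/(IH b b'b) // | nb].
    have -> : below2 u v k b c = below2 u v k n c.
      by apply: eq_bigr => i _; rewrite !(leq_trans (un i _)) // ltnW.
    by have := IH n (Pn b' Pb') (leqnn n); rewrite !Fn // ltnW.
  have : ~~ P' c by apply: contraL c'c => /maxc'; rewrite -leqNgt.
  by move=> /existsPn /(_ (Ordinal (bn : b < n.+1))) /=; rewrite b'b -ltnNge.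
set U := (W :&: F b' + W :&: G c')%VS.
have UW : (U <= W)%VS by rewrite subv_add !capvSl.
have [|W' [UW' W'W dimW']] := hyperplane_containing UW.
  apply/negP => /eqP UW_eq; have /existsP[b1 /andP[b'b1 leb1]] := P'c'.
  set T := (W :&: (F b1 :&: G c'))%VS in leb1.
  have sub : (W :&: F b1 <= W :&: F b' + T)%VS.
    apply/subvP => y; rewrite memv_cap -{1}UW_eq => /andP[/memv_addP[f fW [g gW ->]]] yF.
    have fF1 : f \in F b1.
      by move: fW; rewrite memv_cap => /andP[_]; apply: subvP; apply/Fmono/ltnW.
    move: gW yF; rewrite memv_cap => /andP[gW gG]; rewrite rpredDl // => gF.
    by rewrite memv_add // !memv_cap gW gF.
  have capT : (W :&: (F b' :&: G c') <= W :&: F b' :&: T)%VS.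
    apply/subvP => y; rewrite !memv_cap => /and3P[-> yF ->].
    by rewrite yF (subvP (Fmono _ _ (ltnW b'b1)) _ yF).
  have nPb1 : below u k b1 < \dim (W :&: F b1).
    by rewrite ltnNge; apply: contraL b'b1 => /maxb'; rewrite -leqNgt.
  have := dimvS sub; have := dimvS capT; have := dimv_sum_cap (W :&: F b') T.
  have := incW b' c'; have := below2_incl_excl u v k c' (ltnW b'b1).
  move: Pb'; rewrite /P; lia.
exists W'; split=> // [|b c]; first by lia.
have keep X : (W :&: X <= W')%VS -> \dim (W :&: X) <= \dim (W' :&: X).
  by move=> WX; apply: dimvS; rewrite subv_cap WX capvSr.
case: (leqP b b') => [bb' | b'b].
  apply: leq_trans (incW b c) (keep _ _); apply: subv_trans UW'.
  apply: subv_trans (addvSl _ _); apply: capvS => //.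
  by rewrite (subv_trans (capvSl _ _)) ?Fmono.
case: (leqP c c') => [cc' | c'c].
  apply: leq_trans (incW b c) (keep _ _); apply: subv_trans UW'.
  apply: subv_trans (addvSr _ _); apply: capvS => //.
  by rewrite (subv_trans (capvSr _ _)) ?Gmono.
have := room b c b'b c'c; have := dim_capv_sub (F b :&: G c) W'W; lia.
Qed.

(** Peeling off hyperplanes gives a chain in which [C j] satisfies the conditions
of the first [j] pairs of entries, whatever their order. *)
Lemma incident_flagged n k F u G v W :
  exhaustive n F -> exhaustive n G ->
  (forall i, i < k -> u i <= n) -> (forall i, i < k -> v i <= n) ->
  \dim W = k -> incident k F u G v W -> flagged predT k F u G v W.
Proof.
move=> exF exG un vn dimW incW.
suff [C [chC Ck incC]] : exists C, [/\ chain k C, C k = W &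
    forall j, j <= k -> incident j F u G v (C j)].
  exists C; split=> // j jk _; have [_ Fn _] := exF; have [_ Gn _] := exG.
  split=> b; first have := incC j jk b n; last have := incC j jk n b.
    by rewrite Gn // capvf below2_below // => i ij; apply: vn; lia.
  by rewrite Fn // capfv below2C below2_below // => i ij; apply: un; lia.
elim: k W un vn dimW incW => [|k IHk] W un vn dimW incW.
  exists (fun=> W); split=> // [|j]; last by rewrite leqn0 => /eqP->.
  by split=> [j|//]; rewrite leqn0 => /eqP->.
have un' i : i < k -> u i <= n by move=> ik; apply: un; lia.
have vn' i : i < k -> v i <= n by move=> ik; apply: vn; lia.
have [|W' [W'W dimW' incW']] := incident_hyperplane exF exG un' vn' dimW.
  by move=> b c; apply: leq_trans (incW b c); rewrite below2S leq_addr.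
have [C [[dimC subC] Ck incC]] := IHk W' un' vn' dimW' incW'.
exists (fun j => if j <= k then C j else W); rewrite ltnn; split=> //.
  split=> j jk; first by case: leqP => kj; rewrite ?dimC // dimW; lia.
  rewrite -ltnS jk; case: ltnP => jk'; first exact: subC.
  by rewrite (_ : j = k) ?Ck //; lia.
move=> j jk; case: leqP => kj; first exact: incC.
by have -> : j = k.+1 by lia.
Qed.

(** As [u] increases, the entries at most [b] are the first [j] ones for some
[j], and then [C j] lies in [F b]. *)
Lemma flagged_incident k F u G v W :
  (forall a b, a <= b -> (F a <= F b)%VS) ->
  (forall i, i.+1 < k -> u i < u i.+1) ->
  flagged predT k F u G v W -> \dim W = k /\ incident k F u G v W.
Proof.
move=> Fmono incr [C [chC Ck HC]]; have [dimC _] := chC.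
split=> [|b c]; first by rewrite -Ck dimC.
have [j jk uj] : exists2 j, j <= k & forall i, i < k -> (u i <= b) = (i < j).
  elim: k incr {chC dimC Ck HC} => [|k IHk] incr; first by exists 0.
  case: IHk => [i ik | j jk uj]; first by apply: incr; lia.
  case: (leqP (u k) b) => ukb.
    exists k.+1 => // i ik; rewrite ik.
    have mono m : i + m <= k -> u i <= u (i + m).
      elim: m => [|m IHm] im; first by rewrite addn0.
      rewrite addnS; apply: leq_trans (IHm _) (ltnW (incr _ _)); lia.
    by have := mono (k - i) ltac:(lia); rewrite subnKC //; lia.
  exists j => [|i]; first exact: leqW.
  rewrite ltnS leq_eqVlt => /predU1P[-> | ik]; last exact: uj.
  by rewrite leqNgt ukb ltnNge jk.
have [ujC vjC] := HC j jk isT.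
have CF : (C j <= F b)%VS.
  rewrite -[X in (X <= _)%VS](_ : (C j :&: F b = C j)%VS) ?capvSr //.
  apply/eqP; rewrite eqEdim capvSl dimC //.
  by have := ujC b; rewrite below_all // => i ij; rewrite uj // (leq_trans ij).
have -> : below2 u v k b c = below v j c.
  rewrite /below2 /below (big_ord_widen _ (fun i => (v i <= c) : nat) jk).
  rewrite [RHS]big_mkcond /=; apply: eq_bigr => i _; rewrite uj //.
  by case: ifP.
apply: leq_trans (vjC c) _; apply: dimvS.
rewrite !subv_cap capvSr (subv_trans (capvSl _ _) CF) /= andbT.
by rewrite (subv_trans (capvSl _ _)) // -Ck; apply: chain_mono jk (leqnn k).
Qed.

End Intervals.

Section Cells.
Variables (K : fieldType) (V : vectType K).
Implicit Types (A D U W : {vspace V}) (C E F G : nat -> {vspace V}).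
Implicit Types (x y : nat -> V).

Definition span_of x k : {vspace V} := <<mkseq x k>>%VS.

Lemma mem_span_of x k i : i < k -> x i \in span_of x k.
Proof. by move=> ik; apply/memv_span/map_f; rewrite mem_iota. Qed.

Lemma span_of_sub x k U : (forall i, i < k -> x i \in U) -> (span_of x k <= U)%VS.
Proof.
by move=> xU; apply/span_subvP => z /mapP[m]; rewrite mem_iota => /xU ? ->.
Qed.

Lemma dim_span_of x k : \dim (span_of x k) <= k.
Proof. by rewrite -[leqRHS](size_mkseq x k) dim_span. Qed.

Lemma span_of0 x : span_of x 0 = 0%VS.
Proof. by rewrite /span_of span_nil. Qed.

Lemma span_ofS x k : span_of x k.+1 = (span_of x k + <[x k]>)%VS.
Proof.
by rewrite /span_of /mkseq -addn1 iotaD map_cat span_cat /= span_seq1.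
Qed.

Lemma span_of_eq x y k :
  \dim (span_of x k) = k -> (forall i, i < k -> x i \in span_of y k) ->
  span_of x k = span_of y k.
Proof.
move=> dimx sub; apply/eqP; rewrite eqEdim span_of_sub //=.
by rewrite dimx dim_span_of.
Qed.

Lemma dim_span_of_cap x k U : \dim (span_of x k) = k ->
  \sum_(i < k) (x i \in U) <= \dim (span_of x k :&: U).
Proof.
elim: k => [|k IHk]; rewrite ?big_ord0 // big_ord_recr span_ofS /= => dimx.
have dimk : \dim (span_of x k) = k.
  apply/eqP; rewrite eqn_leq dim_span_of -ltnS -{1}dimx.
  have := (dimv_add_leqif (span_of x k) <[x k]>).1.
  by rewrite dim_vline; case: (x k != 0%R); lia.
have xk : x k \notin span_of x k.
  apply/negP => xk; move: dimx; rewrite (addv_idPl _) -?memvE // dimk; lia.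
have sub : (span_of x k :&: U <= (span_of x k + <[x k]>) :&: U)%VS.
  by apply: capvS => //; apply: addvSl.
case: (boolP (x k \in U)) => xU; last first.
  by rewrite addn0; apply: leq_trans (IHk dimk) (dimvS sub).
rewrite addn1; apply: leq_ltn_trans (IHk dimk) _.
rewrite -(@dim_addv_line _ _ _ (x k)); last by rewrite memv_cap negb_and xk.
apply: dimvS; rewrite subv_add sub -memvE memv_cap xU andbT.
by rewrite (subvP (addvSr _ _)) // memv_line.
Qed.

Definition in_cell k F u G v W : Prop :=
  \dim W = k /\ exists2 x, W = span_of x k &
    forall i, i < k -> x i \in (F (u i) :&: G (v i))%VS.

Lemma in_cellW k F u G v v' W :
  (forall b c, b <= c -> (G b <= G c)%VS) -> (forall i, i < k -> v i <= v' i) ->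
  in_cell k F u G v W -> in_cell k F u G v' W.
Proof.
move=> Gmono vv' [dimW [x Wx xFG]]; split=> //; exists x => // i ik.
by apply: subvP (xFG i ik); apply: capvS => //; apply/Gmono/vv'.
Qed.

Lemma in_cell_incident k F u G v W :
  (forall b c, b <= c -> (F b <= F c)%VS) ->
  (forall b c, b <= c -> (G b <= G c)%VS) ->
  in_cell k F u G v W -> incident k F u G v W.
Proof.
move=> Fmono Gmono [dimW [x Wx xFG]] b c; rewrite {}Wx in dimW *.
apply: leq_trans (dim_span_of_cap (F b :&: G c) dimW).
apply: leq_sum => i _; case: andP => //= -[ub vc].
by rewrite lt0b; apply: subvP (xFG i _) => //; apply: capvS; [apply: Fmono | apply: Gmono].
Qed.

(** The word [g] is the Bruhat position of the chain [C] relative to [G]: [g j]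
is the first step of [G] with a vector [x j] of [C j.+1] outside [C j]. *)
Lemma chain_adapted n k C G :
  exhaustive n G -> chain k C ->
  exists g x, [/\ C k = span_of x k,
    forall j, j < k -> [/\ g j <= n, x j \in C j.+1 & x j \in G (g j)] &
    forall j, j <= k -> forall c, \dim (C j :&: G c) <= below g j c].
Proof.
move=> [_ Gn Gmono] chC; have [dimC subC] := chC.
pose P j c := ~~ (C j.+1 :&: G c <= C j)%VS.
pose g j := find (P j) (iota 0 n).
pose x j := vpick ((C j.+1 :&: G (g j)) :\: C j).
have gn j : g j <= n by rewrite -[leqRHS](size_iota 0 n) find_size.
have gP j c : c < g j -> (C j.+1 :&: G c <= C j)%VS.
  move=> cg; have := before_find 0 cg; rewrite nth_iota ?(leq_trans cg) //.
  by move=> /negbFE.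
have Pg j : j < k -> P j (g j).
  move=> jk; rewrite /g; case: (boolP (has (P j) (iota 0 n))) => [hP | /hasNfind ->].
    have := nth_find 0 hP; rewrite nth_iota //.
    by rewrite -[ltnRHS](size_iota 0 n) -has_find.
  rewrite size_iota /P Gn // capvf; apply/negP => /dimvS.
  by rewrite !dimC ?ltnn // ltnW.
have xin j : x j \in (C j.+1 :&: G (g j))%VS.
  by apply: subvP (memv_pick _); apply: diffvSl.
have xnotin j : j < k -> x j \notin C j.
  move=> jk; apply/negP => xC.
  have : x j \in (((C j.+1 :&: G (g j)) :\: C j) :&: C j)%VS.
    by rewrite memv_cap xC andbT memv_pick.
  rewrite capv_diff memv0 vpick0 diffv_eq0; exact/negP/Pg.
exists g, x; split.
- suff sp j : j <= k -> span_of x j = C j by rewrite sp.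
  elim: j => [|j IHj] jk.
    by rewrite span_of0; apply/esym/eqP; rewrite -dimv_eq0 dimC.
  rewrite span_ofS (IHj (ltnW jk)).
  apply/eqP; rewrite eqEdim subv_add subC // -memvE (subvP (capvSl _ _) _ (xin j)).
  by rewrite (dim_addv_line (xnotin j jk)) !dimC ?leqnn // ltnW.
- by move=> j jk; move: (xin j); rewrite memv_cap => /andP[].
elim=> [|j IHj] jk c.
  by rewrite below0 (leq_trans (dimvS (capvSl _ _))) ?dimC.
rewrite belowS; case: (leqP (g j) c) => gc.
  have := dim_capv_sub (G c) (subC j jk); rewrite (dimC _ jk) (dimC _ (ltnW jk)).
  by have := IHj (ltnW jk) c; lia.
rewrite addn0; apply: leq_trans (IHj (ltnW jk) c).
by apply: dimvS; rewrite subv_cap gP // capvSr.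
Qed.

Definition update x (i : nat) (z : V) : nat -> V :=
  fun s => if s == i then z else x s.

(** What is used of a Zariski closed set: it is stable under limits along lines
in the space of bases. *)
Definition limit_closed k (Z : {vspace V} -> Prop) : Prop :=
  forall x i z, i < k -> \dim (span_of x k) = k ->
  (forall t : K, t != 0%R ->
     let xt := update x i (x i + t *: z)%R in
     \dim (span_of xt k) = k -> Z (span_of xt k)) ->
  Z (span_of x k).

(** Two flags in general position, as split by a common basis.  If [F a] and
[G c] fill the space, a vector of [F a' :&: G c'] is the sum of one in [F a] that
stays in [G c'] and one in [G c] that stays in [F a']. *)
Definition opposite n F G : Prop :=
  (forall a c, a + c <= n -> (F a :&: G c)%VS = 0%VS) /\
  (forall a c a' c', n <= a + c ->
     (F a' :&: G c' <= F a :&: G c' + F a' :&: G c)%VS).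

(** Let [x i] and [x j] lie in nested intervals.  Cut the vector [x j] of the
larger interval into [z1 + z2] so that [x i + t *: z1] and [t *: z2 - x i] lie
in two overlapping intervals with the same four ends.  These span the same
plane as [x i + t *: z1] and [x j], which tends to that of [x i] and [x j]. *)
Lemma cell_exchange n k F u G g Z W i j :
  exhaustive n F -> exhaustive n G -> opposite n F G -> limit_closed k Z ->
  i < j -> j < k -> u i <= u j -> g i <= g j ->
  (forall W', in_cell k F u G (exchange i j g) W' -> Z W') ->
  in_cell k F u G g W -> Z W.
Proof.
move=> [_ _ Fmono] [_ _ Gmono] [opp0 oppD] limZ ij jk uij gij subZ [dimW [x Wx xFG]].
have ik := ltn_trans ij jk; rewrite {}Wx in dimW *.
have freex : free (mkseq x k) by rewrite /free -/(span_of x k) dimW size_mkseq.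
have xi0 : x i != 0%R.
  by apply: (free_not0 freex); apply/map_f; rewrite mem_iota.
have ugn : n <= u i + g i.
  rewrite leqNgt; apply: contra xi0 => ug; rewrite -memv0 -(opp0 (u i) (g i)) ?xFG //.
  exact: ltnW.
have [z1 z1P [z2 z2P xj]] := memv_addP (subvP (oppD _ _ (u j) (g j) ugn) _ (xFG j jk)).
apply: (limZ x i z1 ik dimW) => t t0 xt dimxt; apply: subZ; split=> //.
pose x' := update xt j (t *: z2 - x i)%R.
have x'i : x' i = (x i + t *: z1)%R.
  by rewrite /x' /xt /update eqxx ifN //; lia.
have x'j : x' j = (t *: z2 - x i)%R by rewrite /x' /update eqxx.
have x's s : s != i -> s != j -> x' s = x s.
  by move=> si sj; rewrite /x' /xt /update !ifN.
exists x'.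
  apply: span_of_eq => // s sk; case: (eqVneq s j) => [-> | sj].
    have -> : xt j = (t^-1 *: (x' i + x' j))%R.
      rewrite /xt /update ifN ?x'i ?x'j; last by lia.
      by rewrite [(x i + _ + _)%R]addrC addrA subrK -scalerDr scalerK // xj addrC.
    by rewrite memvZ // memvD // mem_span_of.
  have -> : xt s = x' s by rewrite /x' /update ifN.
  exact: mem_span_of.
move=> s sk; rewrite /exchange; case: (eqVneq s i) => [-> | si].
  rewrite x'i memvD ?memvZ //; apply: subvP (xFG i ik).
  by apply: capvS => //; apply: Gmono.
case: (eqVneq s j) => [-> | sj]; last by rewrite x's // xFG.
rewrite x'j memvB ?memvZ //; apply: subvP (xFG i ik).
by apply: capvS => //; apply: Fmono.
Qed.

(** Walk from [g] to [v] in Bruhat order: at the first place [i] where they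
differ [g i < v i], and [g i] can be exchanged with the first later entry in
the range from [g i] to [v i], or raised to [v i] if there is none. *)
Lemma in_cell_limit n k F u G v Z :
  exhaustive n F -> exhaustive n G -> opposite n F G -> limit_closed k Z ->
  (forall i j, i < j -> j < k -> u i <= u j) ->
  (forall i, i < k -> v i <= n) ->
  (forall W, in_cell k F u G v W -> Z W) ->
  forall g, (forall i, i < k -> g i <= n) ->
  (forall j, j <= k -> forall c, below v j c <= below g j c) ->
  forall W, in_cell k F u G g W -> Z W.
Proof.
move=> exF exG opp limZ umono vn cellZ g.
have [_ _ Gmono] := exG.
have [m] := ubnP (\sum_(i < k) (k - i) * (n - g i)).
elim: m g => // m IHm g lt_m gn dom.
case: (boolP [exists i : 'I_k, g i != v i]) => [/existsP[[i1 i1k] /= gvi1] | ]; last first.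
  move=> /existsPn gv W cellW; apply: cellZ; apply: in_cellW cellW => // i ik.
  by have := gv (Ordinal ik); rewrite negbK => /eqP /= ->.
have exi : exists i, (i < k) && (g i != v i) by exists i1; rewrite i1k.
case: (ex_minnP exi) => i /andP[ik gvi] mini {i1 i1k gvi1 exi}.
have pre s : s < i -> g s = v s.
  move=> si; apply: contraTeq (si) => gvs; rewrite -leqNgt; apply: mini.
  by rewrite gvs (ltn_trans si ik).
have pre_below c : below v i c = below g i c.
  by apply: eq_below => s /pre.
have {gvi} gvi : g i < v i.
  have := dom i.+1 ik (v i); rewrite !belowS pre_below leqnn leq_add2l lt0b => gv.
  by rewrite ltn_neqAle gvi.
(* Up to [j] no entry of [g] after [i] lies in the range from [g i] to [v i],
   but the entry [v i] of [v] does: compare the conditions at [c] and [v i]. *)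
have slack c j : i < j <= k -> (forall s, i < s < j -> ~~ (g i < g s <= v i)) ->
    g i <= c < v i -> below v j c < below g j c.
  move=> /andP[ij jk] gap /andP[gc cv].
  suff : below g j (v i) + below v j c < below g j c + below v j (v i).
    by have := dom j jk (v i); lia.
  elim: j ij jk gap => // j IHj; rewrite ltnS leq_eqVlt => /predU1P[<- | ij] jk gap.
    by rewrite !belowS !pre_below; lia.
  have := IHj ij (ltnW jk) (fun s sj => gap s ltac:(lia)).
  by have := gap j ltac:(lia); rewrite !belowS; lia.
case: (boolP [exists j : 'I_k, (i < j) && (g i < g j <= v i)]).
  move=> /existsP[[j1 j1k] /= j1P].
  have exj : exists j, (j < k) && ((i < j) && (g i < g j <= v i)).
    by exists j1; rewrite j1k.
  case: (ex_minnP exj) => j /and3P[jk ij /andP[gij gjv]] minj {j1 j1k j1P exj}.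
  have gap s : i < s < j -> ~~ (g i < g s <= v i).
    move=> /andP[lis lsj]; apply: contraTN (lsj) => gs; rewrite -leqNgt.
    by apply: minj; rewrite lis gs (ltn_trans lsj jk).
  move=> W; apply: (cell_exchange exF exG opp limZ ij jk).
  - exact: umono.
  - exact: ltnW.
  apply: IHm => [|s sk|l lk c].
  - rewrite -ltnS; apply: leq_trans lt_m; rewrite ltnS.
    have := sum_exchange (fun s a => (k - s) * (n - a)) g k ij.
    rewrite ik jk !mul1n; have := gn j jk; nia.
  - by rewrite /exchange; do 2?case: ifP => _; apply: gn.
  have := below_exchange g l c ij; have := dom l lk c; case: (boolP (i < l <= j)).
    move=> /andP[il lj]; have := @slack c l; rewrite il lk => /(_ isT) sl.
    have := sl (fun s sl => gap s ltac:(lia)); lia.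
  by move=> _; rewrite !addn0 => ? ->.
move=> /existsPn noj W cellW.
pose g' s := if s == i then v i else g s.
have {cellW} : in_cell k F u G g' W.
  apply: in_cellW cellW => // s sk; rewrite /g'; case: eqP => // ->; exact: ltnW.
apply: IHm => [|s sk|l lk c].
- rewrite -ltnS; apply: leq_trans lt_m; rewrite ltnS.
  rewrite (bigD1 (Ordinal ik)) //= [ltnRHS](bigD1 (Ordinal ik)) //= /g' eqxx.
  rewrite (eq_bigr (fun s : 'I_k => (k - s) * (n - g s))) => [|s]; last first.
    by rewrite -val_eqE /= => /negPf->.
  by rewrite ltn_add2r; have := vn i ik; nia.
- by rewrite /g'; case: eqP => _; [apply: vn | apply: gn].
have E p : below g' p c + ((i < p) && (g i <= c)) = below g p c + ((i < p) && (v i <= c)).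
  elim: p => [|p IHp]; rewrite ?below0 // !belowS ltnS.
  have -> : g' p = if p == i then v i else g p by [].
  by case: (ltngtP p i) IHp => [pi | ip | ->]; lia.
have := E l; have := dom l lk c; case: (leqP l i) => [_ | il]; first by rewrite !addn0 => ? ->.
have := @slack c l; rewrite il lk => /(_ isT) sl.
have nog s : i < s < l -> ~~ (g i < g s <= v i).
  move=> /andP[lis lsl]; have sk := leq_trans lsl lk.
  by have := noj (Ordinal sk); rewrite /= lis.
have := sl nog; lia.
Qed.
End Cells.

(** * Coordinates and minors *)

Section Coordinates.
Variables (K : fieldType) (n : nat) (V : vectType K) (e : n.-tuple V).
Hypothesis he : basis_of fullv e.
Implicit Types (U W : {vspace V}) (J I : {set 'I_n}).
Local Open Scope ring_scope.

Definition cspan J : {vspace V} := (\sum_(s in J) <[e`_s]>)%VS.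

Lemma coord_decomp x : x = \sum_s coord e s x *: e`_s.
Proof. exact: coord_basis he (memvf x). Qed.

Lemma coord_e (i j : 'I_n) : coord e j e`_i = (i == j)%:R.
Proof. by rewrite coord_free ?(basis_free he). Qed.

Lemma mem_cspan J x :
  reflect (forall s, s \notin J -> coord e s x = 0) (x \in cspan J).
Proof.
apply: (iffP memv_sumP) => [[y yJ ->] s sJ | xJ].
  rewrite linear_sum big1 // => i iJ; have /vlineP[c ->] := yJ i iJ.
  rewrite linearZ /= coord_e; case: eqP => [is_ | _]; last by rewrite mulr0.
  by rewrite is_ (negPf sJ) in iJ.
exists (fun s => coord e s x *: e`_s) => [s _|]; first by rewrite memvZ ?memv_line.
rewrite {1}[x]coord_decomp (bigID (mem J)) /= [X in _ + X]big1 ?addr0 // => s sJ.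
by rewrite xJ // scale0r.
Qed.

Definition separated J U : Prop :=
  forall x, x \in U -> (forall s, s \in J -> coord e s x = 0) -> x = 0.

Lemma separatedT U : separated [set: 'I_n] U.
Proof.
move=> x _ x0; rewrite [x]coord_decomp big1 // => s _.
by rewrite x0 ?scale0r // inE.
Qed.

Definition hyper s : {vspace V} := cspan [set~ s].

Lemma mem_hyper s x : (x \in hyper s) = (coord e s x == 0).
Proof.
apply/mem_cspan/eqP => [-> // | x0 t]; first by rewrite !inE eqxx.
by rewrite !inE negbK => /eqP->.
Qed.

Lemma dim_hyper s U : (\dim U <= (\dim (U :&: hyper s)).+1)%N.
Proof.
have full : (hyper s + <[e`_s]> = fullv)%VS.
  apply/eqP; rewrite eqEsubv subvf; apply/subvP => x _.
  rewrite [x]coord_decomp (bigD1 s) //= addrC memv_add ?memvZ ?memv_line //.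
  apply: rpred_sum => i si; rewrite memvZ // mem_hyper coord_e.
  by rewrite (negPf si).
have := dim_capv_sub U (subvf (hyper s)).
rewrite capfv capvC -full; have := (dimv_add_leqif (hyper s) <[e`_s]>).1.
by rewrite dim_vline; case: (e`_s != 0); lia.
Qed.

Lemma separated_hyper J U s :
  separated J U -> separated (J :\ s) (U :&: hyper s).
Proof.
move=> sepJ x; rewrite memv_cap mem_hyper => /andP[xU /eqP xs] x0.
apply: sepJ xU _ => t tJ; case: (eqVneq t s) => [-> // | ts].
by apply: x0; rewrite !inE ts.
Qed.

Lemma separated_card J U : separated J U -> (\dim U <= #|J|)%N.
Proof.
elim: {J}_.+1 {-2}J (ltnSn #|J|) U => // m IHm J Jm U sepJ.
case: (set_0Vmem J) => [J0 | [s sJ]].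
  have -> : U = 0%VS; last by rewrite dimv0.
  apply/eqP; rewrite -subv0; apply/subvP => x xU; rewrite memv0.
  by apply/eqP/sepJ => // s; rewrite J0 inE.
have cJ := cardsD1 s J; rewrite sJ in cJ.
have := IHm _ _ _ (@separated_hyper _ _ s sepJ); have := dim_hyper s U; lia.
Qed.

Lemma separated_sub J U : separated J U ->
  exists I, [/\ I \subset J, #|I| = \dim U & separated I U].
Proof.
elim: {U}_.+1 {-2}U (ltnSn (\dim U)) J => // m IHm U Um J sepJ.
case: (eqVneq U 0%VS) => [-> | U0].
  exists set0; rewrite sub0set cards0 dimv0; split=> // x.
  by rewrite memv0 => /eqP.
have xU := memv_pick U; set x := vpick U in xU.
have [s sJ xs] : exists2 s, s \in J & coord e s x != 0.
  apply/exists_inP; apply: contraNT U0 => /exists_inPn xJ.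
  rewrite -vpick0; apply/eqP/sepJ => // s /xJ; rewrite negbK => /eqP//.
set U' := (U :&: hyper s)%VS.
have dimU' : (\dim U').+1 = \dim U.
  apply/eqP; rewrite eqn_leq dim_hyper andbT ltnNge; apply: contra xs => UU'.
  have /eqP eqU : U' == U by rewrite eqEdim capvSl.
  by rewrite -mem_hyper; move: xU; rewrite -eqU memv_cap => /andP[].
have [I [IJ cI sepI]] := IHm U' ltac:(lia) _ (@separated_hyper _ _ s sepJ).
have sI : s \notin I by apply/negP => /(subsetP IJ); rewrite !inE eqxx.
exists (s |: I); split; last 1 first.
- move=> y yU y0; apply: sepI => [|t tI]; last by rewrite y0 // inE tI orbT.
  by rewrite memv_cap yU mem_hyper y0 ?setU11 ?eqxx.
- rewrite subUset sub1set sJ; apply: subset_trans IJ _; exact: subD1set.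
by rewrite cardsU1 sI cI add1n.
Qed.

Definition column k (I : ksubset n k) (j : 'I_k) : 'I_n :=
  enum_val (cast_ord (esym (eqP (valP I))) j).

Lemma columnP k (I : ksubset n k) s : s \in val I -> exists j, s = column I j.
Proof.
move=> sI; exists (cast_ord (eqP (valP I)) (enum_rank_in sI s)).
by rewrite /column cast_ordK enum_rankK_in.
Qed.

Lemma column_in k (I : ksubset n k) j : column I j \in val I.
Proof. exact: enum_valP. Qed.

Definition minor k (x : nat -> V) (I : ksubset n k) : K :=
  \det (\matrix_(i < k, j < k) coord e (column I j) (x i)).

Lemma span_of_sumP k (x : nat -> V) y : y \in span_of x k ->
  exists a : 'I_k -> K, y = \sum_i a i *: x i.
Proof.
move=> yx; have sz := size_mkseq x k; have /coord_span -> : y \in <<Tuple (introT eqP sz)>>%VS by [].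
exists (fun i => coord (Tuple (introT eqP sz)) i y); apply: eq_bigr => i _.
by rewrite /= nth_mkseq.
Qed.

Lemma span_of_free k (x : nat -> V) (a : 'I_k -> K) :
  \dim (span_of x k) = k -> \sum_i a i *: x i = 0 -> forall i, a i = 0.
Proof.
move=> dimx a0; have sz := size_mkseq x k.
have : free (Tuple (introT eqP sz)) by rewrite /free /= sz -/(span_of x k) dimx.
move/freeP/(_ a); apply; rewrite -[RHS]a0.
by apply: eq_bigr => i _; rewrite /= nth_mkseq.
Qed.

(** The vectors in the kernel of the square matrix of these columns are the
vectors of the plane whose coordinates in these columns are zero. *)
Lemma minor_neq0 k x (I : ksubset n k) : \dim (span_of x k) = k ->
  minor x I != 0 <-> separated (val I) (span_of x k).
Proof.
move=> dimx; rewrite /minor; set A := \matrix_(i, j) _.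
have vA (v : 'rV_k) : v *m A = 0 <->
    forall s, s \in val I -> coord e s (\sum_i v 0 i *: x i) = 0.
  have E j : (v *m A) 0 j = coord e (column I j) (\sum_i v 0 i *: x i).
    by rewrite linear_sum mxE; apply: eq_bigr => i _; rewrite mxE linearZ.
  split=> [v0 s /columnP[j ->] | v0]; first by rewrite -E v0 mxE.
  by apply/rowP => j; rewrite E v0 ?mxE // column_in.
split=> [A0 y /span_of_sumP[a ->] y0 | sepI].
  apply: contraNeq A0 => a0; apply/det0P; exists (\row_i a i).
    apply: contra_neq a0 => a0; rewrite big1 // => i _.
    by move/rowP/(_ i): a0; rewrite !mxE => ->; rewrite scale0r.
  by apply/vA => s sI; rewrite -[RHS](y0 s sI); congr (coord _ _ _);
    apply: eq_bigr => i _; rewrite mxE.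
apply/negP => /det0P[v v0 /vA vI]; case/negP: v0; apply/eqP/rowP => i.
rewrite mxE; apply: (span_of_free dimx); apply: sepI => //.
by apply: rpred_sum => j _; rewrite memvZ // mem_span_of.
Qed.

Lemma minor_exists k x : \dim (span_of x k) = k ->
  exists I : ksubset n k, minor x I != 0.
Proof.
move=> dimx; have [I [_ cI sepI]] := separated_sub (@separatedT (span_of x k)).
have cIk : #|I| == k by rewrite cI dimx.
by exists (exist _ I cIk); apply/minor_neq0.
Qed.

Lemma minor_change k x y :
  \dim (span_of x k) = k -> span_of x k = span_of y k ->
  exists2 c, c != 0 & forall I : ksubset n k, minor x I = c * minor y I.
Proof.
move=> dimx xy.
have [M xM] : exists M : 'M_k, forall i : 'I_k, x i = \sum_j M i j *: y j.
  have H (i : 'I_k) : exists a : {ffun 'I_k -> K}, x i == \sum_j a j *: y j.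
    have : x i \in span_of y k by rewrite -xy mem_span_of.
    case/span_of_sumP => a ->; exists (finfun a); apply/eqP/eq_bigr => j _.
    by rewrite ffunE.
  exists (\matrix_(i, j) xchoose (H i) j) => i.
  rewrite {1}(eqP (xchooseP (H i))); apply: eq_bigr => j _.
  by rewrite mxE.
have minorM (I : ksubset n k) : minor x I = \det M * minor y I.
  rewrite -det_mulmx; congr (\det _); apply/matrixP => i j.
  rewrite !mxE xM linear_sum; apply: eq_bigr => l _.
  by rewrite mxE linearZ.
exists (\det M) => //; have [I] := minor_exists dimx.
by rewrite minorM mulf_eq0 negb_or => /andP[].
Qed.

Lemma span_of_vbasis k W : \dim W = k -> span_of (nth 0 (vbasis W)) k = W.
Proof.
move=> dimW; rewrite /span_of -[X in mkseq _ X]dimW -{2}(size_tuple (vbasis W)).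
by rewrite mkseq_nth (span_basis (vbasisP W)).
Qed.

Lemma plucker_minor k W (I : ksubset n k) :
  plucker e W I = minor (nth 0 (vbasis W)) I.
Proof. by []. Qed.

(** If the intersection is too small, columns in [J] that separate it and columns
outside [J] that separate a complement of it give a nonzero minor with too many
columns outside [J].  If it is large enough, a nonzero minor on columns [I]
would make the columns in [I :&: J] separate it, and they are too few. *)
Lemma dim_cap_plucker k W J d : \dim W = k ->
  (d <= \dim (W :&: cspan J))%N <->
  forall I : ksubset n k, (k < d + #|val I :\: J|)%N -> plucker e W I = 0.
Proof.
move=> dimW; have spW := span_of_vbasis dimW.
have dimx : \dim (span_of (nth 0 (vbasis W)) k) = k by rewrite spW.
have pluckerP (I : ksubset n k) : plucker e W I != 0 <-> separated (val I) W.
  by rewrite plucker_minor (minor_neq0 _ dimx) spW.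
set U := (W :&: cspan J)%VS; split=> [dU I kI | plW].
  apply/eqP; apply: contraTT kI => /pluckerP sepI; rewrite -leqNgt.
  suff : (\dim U <= #|val I :&: J|)%N.
    by have := cardsID J (val I); rewrite (eqP (valP I)); lia.
  apply: separated_card => x; rewrite memv_cap => /andP[xW /mem_cspan xJ] x0.
  apply: sepI xW _ => s sI; case: (boolP (s \in J)) => [sJ | /xJ //].
  by apply: x0; rewrite inE sI.
rewrite leqNgt; apply/negP => Ud.
have sepU : separated J U.
  move=> x; rewrite memv_cap => /andP[_ /mem_cspan xJ] x0.
  apply: (separatedT (memvf x)) => s _.
  by case: (boolP (s \in J)) => [/x0 | /xJ].
set U1 := (W :\: U)%VS.
have U1U x : x \in U1 -> x \in U -> x = 0.
  by move=> x1 xU; apply/eqP; rewrite -memv0 -(capv_diff W U) memv_cap x1.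
have U1W x : x \in U1 -> x \in W by apply/subvP/diffvSl.
have sepU1 : separated (~: J) U1.
  move=> x x1 x0; apply: U1U => //; rewrite memv_cap U1W //.
  by apply/mem_cspan => s sJ; apply: x0; rewrite inE.
have [I [IJ cI sepI]] := separated_sub sepU.
have [I1 [I1J cI1 sepI1]] := separated_sub sepU1.
have dimU1 : (\dim U1 + \dim U = k)%N.
  by rewrite -dimW -(dimv_cap_compl W U) (capv_idPr (capvSl _ _)) addnC /U1 /diffv.
have disj : [disjoint I & I1].
  rewrite disjoints_subset; apply: subset_trans IJ _; rewrite -[J]setCK.
  by rewrite setCS.
have cII1 : #|I :|: I1| == k.
  by rewrite cardsU (disjoint_setI0 disj) cards0 subn0 cI cI1 addnC dimU1.
have := plW (exist _ (I :|: I1) cII1).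
have -> : (I :|: I1) :\: J = I1.
  rewrite setDUl; have /eqP -> : I :\: J == set0 by rewrite setD_eq0.
  by rewrite set0U setDE; apply/setIidPl.
rewrite cI1 => pl0; have {}pl0 := pl0 ltac:(lia).
suff /pluckerP : separated (val (exist _ (I :|: I1) cII1 : ksubset n k)) W.
  by rewrite pl0 eqxx.
move=> x xW x0.
have : x \in (U1 + U)%VS by rewrite -[U](capv_idPr (capvSl _ _)) addv_diff_cap.
case/memv_addP => x1 xU1 [x2 xU2 xx].
have x10 : x1 = 0.
  apply: sepI1 => // s sI1; have := x0 s; rewrite inE sI1 orbT xx linearD /=.
  move: xU2; rewrite memv_cap => /andP[_ /mem_cspan/(_ s)->]; first by rewrite addr0; apply.
  by have := subsetP I1J s sI1; rewrite inE.
rewrite xx x10 add0r; apply: sepI => // s sI; have := x0 s.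
by rewrite inE sI xx x10 add0r; apply.
Qed.

End Coordinates.

(** * Zariski closed sets *)

Section Closed.
Variables (K : fieldType) (n : nat) (V : vectType K) (e : n.-tuple V).
Hypothesis he : basis_of fullv e.
Implicit Types (U W : {vspace V}) (J : {set 'I_n}).
Local Open Scope ring_scope.

Lemma meval_dhomog m (p : {mpoly K[m]}) d (c : K) (w : 'I_m -> K) :
  p \is d.-homog -> p.@[fun i => c * w i] = c ^+ d * p.@[w].
Proof.
move=> /dhomogP hp; rewrite !mevalE mulr_sumr; apply: eq_big_seq => a /hp da.
rewrite mulrCA; congr (_ * _).
rewrite (eq_bigr (fun i => c ^+ a i * w i ^+ a i)) => [|i _]; last exact: exprMn.
by rewrite big_split /= prodrXr -mdegE da.
Qed.

Lemma poly_eq0 (q : {poly K}) :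
  [pchar K] =i pred0 -> (forall t, q.[t] = 0) -> q = 0.
Proof.
move=> /pcharf0P char0 q0; apply: contraTeq isT => qn0.
have natr_inj : injective (fun m : nat => m%:R : K).
  move=> a b; wlog ab : a b / (a <= b)%N => [IH eqab | eqab].
    by case/orP: (leq_total a b) => [/IH | /IH/(_ (esym eqab))]; [apply | ].
  by apply/eqP; rewrite eqn_leq ab -subn_eq0 -char0 natrB // eqab subrr eqxx.
have := max_poly_roots qn0 (_ : all (root q) [seq i%:R | i <- iota 0 (size q)]).
rewrite size_map size_iota ltnn map_inj_uniq ?iota_uniq //; apply=> //.
by apply/allP => t _; rewrite /root q0.
Qed.

Lemma minor_dim k (x : nat -> V) (I : ksubset n k) :
  minor e x I != 0 -> \dim (span_of x k) = k.
Proof.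
move=> mx; have sz := size_mkseq x k.
suff : free (Tuple (introT eqP sz)) by rewrite /free /= sz => /eqP.
apply/freeP => a a0 i; apply: contraNeq mx => ai; apply/det0P.
exists (\row_i a i); first by apply: contra_neq ai => /rowP/(_ i); rewrite !mxE.
apply/rowP => j; rewrite !mxE.
transitivity (coord e (column I j) (\sum_i a i *: x i)).
  by rewrite linear_sum; apply: eq_bigr => s _; rewrite !mxE linearZ.
suff -> : \sum_i a i *: x i = 0 by rewrite linear0.
by rewrite -[RHS]a0; apply: eq_bigr => s _; rewrite /= nth_mkseq.
Qed.

Lemma minor_update k (x : nat -> V) i z t (I : ksubset n k) : (i < k)%N ->
  minor e (update x i (x i + t *: z)) I
  = minor e x I + t * minor e (update x i z) I.
Proof.
move=> ik; transitivity (1 * minor e x I + t * minor e (update x i z) I); last first.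
  by rewrite mul1r.
apply: (determinant_multilinear (i0 := Ordinal ik)).
- by apply/rowP => j; rewrite !mxE /update /= eqxx linearD linearZ mul1r.
- apply/matrixP => s j; rewrite !mxE /update ifN //=.
  by have := neq_lift (Ordinal ik) s; rewrite -val_eqE eq_sym.
apply/matrixP => s j; rewrite !mxE /update !ifN //=;
  by have := neq_lift (Ordinal ik) s; rewrite -val_eqE eq_sym.
Qed.

Lemma minors_vanish k (x : nat -> V) (p : {mpoly K[#|{: ksubset n k}|]}) d :
  p \is d.-homog -> \dim (span_of x k) = k ->
  (p.@[fun a => plucker e (span_of x k) (enum_val a)] == 0)
  = (p.@[fun a => minor e x (enum_val a)] == 0).
Proof.
move=> hp dimx.
have [c c0 xc] := minor_change he dimx (esym (span_of_vbasis dimx)).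
have -> : p.@[fun a => minor e x (enum_val a)]
        = p.@[fun a => c * plucker e (span_of x k) (enum_val a)].
  by apply: meval_eq => a; rewrite xc.
by rewrite (meval_dhomog _ _ hp) mulf_eq0 expf_eq0 (negPf c0) andbF.
Qed.

(** Along a line in the space of bases the minors are affine functions of the
parameter, so a polynomial equation that holds at almost all points of the line
holds at all of them. *)
Lemma zariski_closed_limit k (Z : set {vspace V}) :
  [pchar K] =i pred0 -> zariski_closed e k Z -> limit_closed k Z.
Proof.
move=> char0 [S [homS ->]] x i z ik dimx Zt; split=> // p Sp.
have [d hp] := homS p Sp; apply/eqP; rewrite (minors_vanish hp dimx).
pose line (I : ksubset n k) : {poly K} :=
  (minor e x I)%:P + minor e (update x i z) I *: 'X.
have lineE I t : (line I).[t] = minor e (update x i (x i + t *: z)) I.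
  by rewrite minor_update // !hornerE mulrC.
pose q : {poly K} := mmap polyC (fun a => line (enum_val a)) p.
have qE t : q.[t] = p.@[fun a => minor e (update x i (x i + t *: z)) (enum_val a)].
  rewrite /q /mmap mevalE horner_sum; apply: eq_bigr => a _.
  rewrite hornerCM horner_prod; congr (_ * _); apply: eq_bigr => s _.
  by rewrite horner_exp lineE.
have update0 (I : ksubset n k) : minor e (update x i (x i + 0 *: z)) I = minor e x I.
  by rewrite minor_update // mul0r addr0.
have [I0 mI0] := minor_exists he dimx.
(* The equation is known at [t] only if [t] is nonzero and the vectors are
   independent, so it is multiplied by ['X] and by a minor that is not zero. *)
have r0 : line I0 != 0.
  by apply: contraNneq mI0 => r0; rewrite -update0 -lineE r0 horner0.
have : q * line I0 * 'X = 0.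
  apply: (poly_eq0 char0) => t; rewrite !hornerM hornerX.
  case: (eqVneq t 0) => [-> | t0]; first by rewrite mulr0.
  rewrite lineE; case: (eqVneq (minor e (update x i (x i + t *: z)) I0) 0) => [-> | mt].
    by rewrite mulr0 mul0r.
  have dimt := minor_dim mt; have [_ /(_ p Sp)/eqP] := Zt t t0 dimt.
  by rewrite (minors_vanish hp dimt) -qE => /eqP->; rewrite !mul0r.
move/eqP; rewrite !mulf_eq0 (negPf r0) polyX_eq0 !orbF => /eqP q0.
have := qE 0; rewrite q0 horner0 => /esym p0; apply/eqP; rewrite -[RHS]p0.
by apply: meval_eq => a; rewrite update0.
Qed.

Lemma zariski_closed_dim_cap k J d :
  zariski_closed e k [set W | \dim W = k /\ (d <= \dim (W :&: cspan e J))%N]%classic.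
Proof.
exists [set p | exists2 I : ksubset n k,
  (k < d + #|val I :\: J|)%N & p = 'X_(enum_rank I)]%classic; split.
  by move=> p [I _ ->]; exists 1%N; rewrite dhomogX /= mdeg1.
apply/seteqP; split=> W /=.
  move=> [dimW /(dim_cap_plucker he J d dimW) pW]; split=> // p [I kI ->].
  by rewrite mevalXU enum_rankK pW.
move=> [dimW pW]; split=> //; apply/(dim_cap_plucker he J d dimW) => I kI.
have := pW 'X_(enum_rank I) (ex_intro2 _ _ I kI erefl).
by rewrite mevalXU enum_rankK.
Qed.

End Closed.

(** * Partial flags and chains *)

Section PartialFlags.
Variables (K : fieldType) (V : vectType K).
Implicit Types (A D U W : {vspace V}) (C E : nat -> {vspace V}) (x : nat -> V).
Implicit Types (ks us : seq nat).

Lemma dim_span_of_prefix x j k :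
  j <= k -> \dim (span_of x k) = k -> \dim (span_of x j) = j.
Proof.
elim: k => [|k IHk]; first by rewrite leqn0 => /eqP->.
rewrite leq_eqVlt => /predU1P[-> // | jk] dimk; apply: IHk => //.
apply/eqP; rewrite eqn_leq dim_span_of -ltnS -{1}dimk span_ofS.
have := (dimv_add_leqif (span_of x k) <[x k]>).1.
by rewrite dim_vline; case: (x k != 0%R); lia.
Qed.

(** One basis adapted to all spaces of a partial flag; its initial segments span
the chain that refines the flag. *)
Lemma partial_flag_basis (fl : seq {vspace V}) :
  sorted (fun U W => (U <= W)%VS) fl ->
  exists2 x, forall U, U \in fl -> U = span_of x (\dim U) &
             last 0%VS fl = span_of x (\dim (last 0%VS fl)).
Proof.
elim/last_ind: fl => [_ | fl D IHfl sfl].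
  by exists (fun=> 0%R); rewrite //= dimv0 span_of0.
have [x xfl xA] : exists2 x, forall U, U \in fl -> U = span_of x (\dim U) &
             last 0%VS fl = span_of x (\dim (last 0%VS fl)).
  by apply: IHfl; move: sfl; rewrite -cats1 => /cat_sorted2[].
set A := last 0%VS fl in xA; set a := \dim A.
have AD : (A <= D)%VS.
  move: sfl; rewrite /A; case: fl {IHfl xfl xA A a} => [|U fl]; first by rewrite sub0v.
  by rewrite rcons_cons /= rcons_path => /andP[].
have flA U : U \in fl -> (U <= A)%VS.
  move=> /(nthP 0%VS)[i ifl <-]; rewrite /A -nth_last.
  have tr : transitive (fun U W : {vspace V} => (U <= W)%VS).
    by move=> U1 U2 U3; apply: subv_trans.
  apply: (sorted_leq_nth tr (@subvv _ _)).
  - by move: sfl; rewrite -cats1 => /cat_sorted2[].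
  - by rewrite inE.
  - by rewrite inE prednK // (leq_trans _ ifl).
  by rewrite -ltnS prednK // (leq_trans _ ifl).
pose y i := if i < a then x i else nth 0%R (vbasis (D :\: A)) (i - a).
have yx j : j <= a -> span_of y j = span_of x j.
  move=> ja; congr <<_>>%VS; apply/eq_in_map => s; rewrite mem_iota /= => sj.
  by rewrite /y (leq_trans sj).
have dimD : \dim D = a + \dim (D :\: A).
  by have := dimv_cap_compl D A; rewrite (capv_idPr AD) /diffv -/a; lia.
have yD : span_of y (\dim D) = D.
  apply/eqP; rewrite eqEsubv; apply/andP; split.
    apply: span_of_sub => i iD; rewrite /y; case: ltnP => ia.
      by apply: (subvP AD); rewrite xA mem_span_of.
    apply: (subvP (diffvSl D A)); apply: vbasis_mem; apply: mem_nth.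
    by rewrite size_tuple; lia.
  rewrite -[X in (X <= _)%VS](addv_diff_cap D A) subv_add; apply/andP; split.
    rewrite -{1}(span_basis (vbasisP (D :\: A))); apply/span_subvP => z.
    move=> /tnthP[i ->]; rewrite (tnth_nth 0%R).
    have -> : nth 0%R (vbasis (D :\: A)) i = y (a + i).
      by rewrite /y ltnNge leq_addr addKn.
    by apply: mem_span_of; rewrite dimD ltn_add2l.
  rewrite (capv_idPr AD) xA; apply: span_of_sub => i ia.
  have -> : x i = y i by rewrite /y ia.
  by apply: mem_span_of; lia.
exists y; last by rewrite last_rcons yD.
move=> U; rewrite mem_rcons inE => /predU1P[-> // | Ufl].
by rewrite yx ?dimvS ?flA //; apply: xfl.
Qed.

Lemma flag_dims_nth k ks i j : flag_dims k ks -> i <= j -> j < size ks ->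
  nth 0 ks i <= nth 0 ks j.
Proof.
move=> [/path_sorted sks _] ij jks.
apply: (sorted_leq_nth leq_trans leqnn) => //; last first.
- by rewrite inE (leq_ltn_trans ij).
by apply: sub_sorted sks => a b /ltnW.
Qed.

Lemma flag_dims_le k ks j : flag_dims k ks -> j < size ks -> nth 0 ks j <= k.
Proof.
move=> fks jks; have [_ <-] := fks; rewrite -nth_last.
by apply: (flag_dims_nth fks); lia.
Qed.

Lemma color_le k ks i j : flag_dims k ks -> j < size ks ->
  (color ks i <= j) = (i < nth 0 ks j).
Proof.
move=> fks jks; apply/idP/idP => [cj | ij]; last first.
  by rewrite leqNgt; apply/negP => /(before_find 0); rewrite ij.
have hks : has (fun a => i < a) ks by rewrite has_find (leq_ltn_trans cj).
by apply: leq_trans (nth_find 0 hks) _; apply: (flag_dims_nth fks).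
Qed.

Lemma card_color k ks us j b : flag_dims k ks -> size us = k -> j < size ks ->
  #|[pred l : 'I_(size us) | (nth 0 us l <= b) && (color ks l <= j)]|
  = below (nth 0 us) (nth 0 ks j) b.
Proof.
move=> fks sus jks; rewrite -sum1_card /below.
have le_us : nth 0 ks j <= size us by rewrite sus (flag_dims_le fks).
rewrite (big_ord_widen _ (fun l => (nth 0 us l <= b) : nat) le_us).
rewrite big_mkcond [RHS]big_mkcond /=; apply: eq_bigr => l _.
by rewrite inE (color_le _ fks jks) andbC; case: (l < _); case: (_ <= b).
Qed.

(** The conditions at the values of [u] imply those at all [b], as the count is
constant between two values of [u]. *)
Lemma schubertE n k ks us E (fl : seq {vspace V}) : exhaustive n E ->
  flag_dims k ks -> schubert_index n ks us -> partial_flag ks fl ->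
  schubert ks us E fl <->
  forall j, j < size ks -> schubert_at E (nth 0 us) (nth 0 ks j) (nth 0%VS fl j).
Proof.
move=> [_ _ Emono] fks [sus _ rus _] pfl; rewrite fks.2 in sus.
have us_gt0 i : i < size us -> 0 < nth 0 us i.
  by move=> ius; have /andP[] := allP rus _ (mem_nth 0 ius).
split=> [[_ H] j jks | H]; last first.
  by split=> // i j ius jks; rewrite (card_color _ fks sus jks); apply: H.
have H' i : i < size us -> below (nth 0 us) (nth 0 ks j) (nth 0 us i)
    <= \dim (nth 0%VS fl j :&: E (nth 0 us i)).
  by move=> ius; rewrite -(card_color _ fks sus jks); apply: H.
have le_us : nth 0 ks j <= size us by rewrite sus (flag_dims_le fks).
elim=> [|b IHb].
  by rewrite below_none // => i ij; apply: us_gt0; apply: leq_trans ij le_us.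
case: (boolP (b.+1 \in us)) => [bus | bus].
  by have := H' (index b.+1 us); rewrite index_mem nth_index //; apply.
have -> : below (nth 0 us) (nth 0 ks j) b.+1 = below (nth 0 us) (nth 0 ks j) b.
  apply: eq_bigr => i _; rewrite [in LHS]leq_eqVlt ltnS; case: eqP => // ib.
  by case/negP: bus; rewrite -ib mem_nth // (leq_trans (ltn_ord i)).
by apply: leq_trans IHb _; apply/dimvS/capvS => //; apply: Emono.
Qed.

Lemma image_flagged n k ks us vs F G W :
  exhaustive n F -> exhaustive n G -> 0 < k -> flag_dims k ks ->
  schubert_index n ks us -> schubert_index n ks vs ->
  (exists2 fl, schubert ks us F fl /\ schubert ks vs G fl & last 0%VS fl = W) <->
  flagged (mem ks) k F (nth 0 us) G (nth 0 vs) W.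
Proof.
move=> exF exG k0 fks ius ivs; split=> [[fl [sF sG] Wfl] | [C [chC Ck HC]]].
  have pfl := sF.1; have [sfl dfl] := pfl.
  have szfl : size fl = size ks by rewrite -dfl size_map.
  have [x xfl xW] := partial_flag_basis sfl.
  have dimW : \dim (last 0%VS fl) = k.
    by rewrite -fks.2 -dfl; case: (fl) => [|U s] /=; rewrite ?dimv0 ?last_map.
  rewrite dimW in xW; exists (span_of x); split; last first.
  - move=> j _ /(nthP 0)[i iks <-].
    have -> : span_of x (nth 0 ks i) = nth 0%VS fl i.
      by rewrite -dfl (nth_map 0%VS) ?szfl // -xfl // mem_nth ?szfl.
    split; first by apply: (schubertE exF fks ius pfl).1.
    by apply: (schubertE exG fks ivs pfl).1.
  - by rewrite -xW.
  split=> [j jk | j jk]; last by rewrite span_ofS addvSl.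
  by apply: (dim_span_of_prefix jk); rewrite -xW.
have [dimC _] := chC.
pose fl := [seq C j | j <- ks].
have pfl : partial_flag ks fl.
  split.
    apply/(sortedP 0%VS) => i; rewrite size_map => iks.
    rewrite !(nth_map 0) //; last exact: ltnW.
    by apply: (chain_mono chC); [apply: (flag_dims_nth fks) | apply: (flag_dims_le fks)].
  rewrite -map_comp -[RHS]map_id; apply/eq_in_map => j /(nthP 0)[i iks <-] /=.
  by rewrite dimC // (flag_dims_le fks).
have HC' j : j < size ks -> schubert_at F (nth 0 us) (nth 0 ks j) (nth 0%VS fl j) /\
                            schubert_at G (nth 0 vs) (nth 0 ks j) (nth 0%VS fl j).
  move=> jks; rewrite (nth_map 0) //; apply: HC; first exact: (flag_dims_le fks).
  exact: mem_nth.
exists fl; first split.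
- by apply/(schubertE exF fks ius pfl) => j /HC'[].
- by apply/(schubertE exG fks ivs pfl) => j /HC'[].
rewrite -Ck /fl -fks.2; case: ks {fl pfl HC' ius ivs HC} fks => [[_ k0']|a ks _ /=].
  by rewrite -k0' in k0.
by rewrite last_map.
Qed.

End PartialFlags.

(** * Rank sets as pairs of words *)

Section RankSets.
Variable n : nat.

Definition rank_word (M : seq (nat * nat)) (i : nat) : nat := (nth (0, 0) M i).2.
Definition corank_word (M : seq (nat * nat)) (i : nat) : nat :=
  n.+1 - (nth (0, 0) M i).1.

Lemma rank_set_nth k M i : rank_set n k M -> i < k ->
  [/\ 1 <= (nth (0, 0) M i).1, (nth (0, 0) M i).1 <= (nth (0, 0) M i).2
    & (nth (0, 0) M i).2 <= n].
Proof.
move=> [sM aM _ _] ik; have iM : i < size M by rewrite sM.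
by have := allP aM _ (mem_nth (0, 0) iM) => /andP[/andP[]].
Qed.

Lemma below2_seq k M b c : rank_set n k M ->
  below2 (rank_word M) (corank_word M) k b c
  = \sum_(p <- M) ((p.2 <= b) && (n.+1 - p.1 <= c)).
Proof.
move=> [sM _ _ _]; rewrite (big_nth (0, 0)) big_mkord sM.
by apply: eq_bigr.
Qed.

Lemma rank_set_words k M : rank_set n k M ->
  good_word n k (rank_word M) /\ good_word n k (corank_word M).
Proof.
move=> rM; have [sM _ u1 u2] := rM; split; split=> [i ik | i j ik jk].
- by have [] := rank_set_nth rM ik; rewrite /rank_word; lia.
- rewrite /rank_word -!(nth_map (0, 0) 0 snd) ?sM // => /eqP.
  by rewrite nth_uniq ?size_map ?sM // => /eqP.
- by have [] := rank_set_nth rM ik; rewrite /corank_word; lia.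
have [i1 i2 i3] := rank_set_nth rM ik; have [j1 j2 j3] := rank_set_nth rM jk.
rewrite /corank_word => ij; have {ij} : (nth (0, 0) M i).1 = (nth (0, 0) M j).1 by lia.
rewrite -!(nth_map (0, 0) 0 fst) ?sM // => /eqP.
by rewrite nth_uniq ?size_map ?sM // => /eqP.
Qed.

Lemma rank_set_sort k M : rank_set n k M ->
  exists M', [/\ rank_set n k M', perm_eq M' M &
    forall i, i.+1 < k -> rank_word M' i < rank_word M' i.+1].
Proof.
move=> rM; pose r := relpre (@snd nat nat) leq; exists (sort r M).
have pM : perm_eq (sort r M) M by rewrite perm_sort.
have [sM aM u1 u2] := rM.
have rM' : rank_set n k (sort r M).
  split; first by rewrite size_sort.
  - by rewrite all_sort.
  - by rewrite (perm_uniq (perm_map _ pM)).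
  by rewrite (perm_uniq (perm_map _ pM)).
split=> // i ik; have [_ inj] := (rank_set_words rM').1.
rewrite ltn_neqAle; apply/andP; split.
  by apply/eqP => /(inj _ _ (ltnW ik) ik); lia.
have : sorted r (sort r M) by apply: sort_sorted => p q; apply: leq_total.
by move=> /(sortedP (0, 0))/(_ i); rewrite size_sort sM; apply.
Qed.

End RankSets.

(** * The coordinate flags *)

Section CoordinateFlags.
Variables (K : fieldType) (n : nat) (V : vectType K) (e : n.-tuple V).
Implicit Types (U W : {vspace V}) (J : {set 'I_n}).

Lemma span_cspan (s : seq V) J :
  (forall y, y \in s <-> exists2 i, i \in J & y = nth 0%R e i) ->
  <<s>>%VS = cspan e J.
Proof.
move=> sJ; apply/eqP; rewrite eqEsubv; apply/andP; split.
  apply/span_subvP => y /sJ[i iJ ->]; apply: subvP (memv_line _).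
  by rewrite /cspan (sumv_sup i).
apply/subv_sumP => i iJ; rewrite -memvE memv_span //; apply/sJ.
by exists i.
Qed.

Lemma nth_eP y (P : pred nat) :
  (exists2 i, i < n & P i /\ y = nth 0%R e i) <->
  exists2 i : 'I_n, i \in [set i : 'I_n | P i] & y = nth 0%R e i.
Proof.
split=> [[i ii [Pi ->]] | [i iP ->]].
  by exists (Ordinal ii); rewrite ?inE.
by exists i => //; split=> //; rewrite inE in iP.
Qed.

Lemma flagFE b : flagF e b = cspan e [set i : 'I_n | i < b].
Proof.
apply: span_cspan => y; rewrite -(nth_eP y (fun i => i < b)); split.
  move=> /(nthP 0%R)[m]; rewrite size_take_min size_tuple ltn_min => /andP[mb mn].
  by rewrite nth_take // => <-; exists m.
move=> [i ii [ib ->]]; apply/(nthP 0%R); exists i.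
  by rewrite size_take_min size_tuple ltn_min ib.
by rewrite nth_take.
Qed.

Lemma flagGE c : flagG e c = cspan e [set i : 'I_n | n <= i + c].
Proof.
apply: span_cspan => y; rewrite -(nth_eP y (fun i => n <= i + c)); split.
  move=> /(nthP 0%R)[m]; rewrite size_take_min size_rev size_tuple ltn_min => /andP[mc mn].
  rewrite nth_take // nth_rev ?size_tuple // => <-.
  by exists (n - m.+1); [lia | split=> //; lia].
move=> [i ii [ic ->]]; apply/(nthP 0%R); exists (n - i.+1).
  by rewrite size_take_min size_rev size_tuple; lia.
rewrite nth_take; last by lia.
by rewrite nth_rev size_tuple; [congr nth; lia | lia].
Qed.

Lemma rank_cell_perm M M' W : perm_eq M' M -> rank_cell e M' W -> rank_cell e M W.
Proof.
rewrite perm_sym => /(perm_iotaP (0, 0))[s ps ->] [b [bW]].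
rewrite all2E => /andP[/eqP szb /(all_nthP (0%R, (0, 0))) bM].
exists [seq nth 0%R b i | i <- s]; split.
  rewrite -(@perm_basis _ _ b) // -{1}(mkseq_nth 0%R b).
  by rewrite perm_sym perm_map // szb.
rewrite all2E !size_map eqxx /=.
have : {subset s <= iota 0 (size M')} by move=> i; rewrite (perm_mem ps).
elim: s {ps} => //= i s IHs si; rewrite IHs ?andbT; last first.
  by move=> j js; apply: si; rewrite inE js orbT.
have iM : i < size M' by have := si i (mem_head _ _); rewrite mem_iota.
have := bM i; rewrite size_zip szb minnn nth_zip //=; exact.
Qed.

Hypothesis he : basis_of fullv e.

Lemma cspanI J J' : (cspan e J :&: cspan e J' = cspan e (J :&: J'))%VS.
Proof.
apply/vspaceP => x; rewrite memv_cap; apply/andP/(mem_cspan he).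
  move=> [/(mem_cspan he) xJ /(mem_cspan he) xJ'] s; rewrite inE negb_and.
  by case/orP; [apply: xJ | apply: xJ'].
by move=> xJ; split; apply/(mem_cspan he) => s sJ; apply: xJ; rewrite inE negb_and sJ ?orbT.
Qed.

Lemma cspanS J J' : J \subset J' -> (cspan e J <= cspan e J')%VS.
Proof.
move=> JJ'; apply/subvP => x /(mem_cspan he) xJ; apply/(mem_cspan he) => s sJ'.
by apply: xJ; apply: contra sJ'; apply: subsetP.
Qed.

Lemma cspanT : cspan e [set: 'I_n] = fullv.
Proof.
apply/eqP; rewrite eqEsubv subvf; apply/subvP => x _.
by apply/(mem_cspan he) => s; rewrite inE.
Qed.

Lemma cspan0 : cspan e set0 = 0%VS.
Proof. by rewrite /cspan big_set0. Qed.

Lemma flagF_exhaustive : exhaustive n (flagF e).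
Proof.
split=> [|b nb|a b ab]; rewrite !flagFE.
- by rewrite -cspan0; congr cspan; apply/setP => i; rewrite !inE.
- by rewrite -cspanT; congr cspan; apply/setP => i; rewrite !inE (leq_trans (ltn_ord i)).
by apply: cspanS; apply/subsetP => i; rewrite !inE => /leq_trans; apply.
Qed.

Lemma flagG_exhaustive : exhaustive n (flagG e).
Proof.
split=> [|b nb|a b ab]; rewrite !flagGE.
- by rewrite -cspan0; congr cspan; apply/setP => i; rewrite !inE addn0 leqNgt ltn_ord.
- by rewrite -cspanT; congr cspan; apply/setP => i; rewrite !inE; lia.
by apply: cspanS; apply/subsetP => i; rewrite !inE; lia.
Qed.

Lemma opposite_flags : opposite n (flagF e) (flagG e).
Proof.
split=> [a c ac | a c a' c' ac].
  rewrite flagFE flagGE cspanI -cspan0; congr cspan; apply/setP => i; rewrite !inE; lia.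
rewrite !flagFE !flagGE !cspanI.
set J := _ :&: _; set J1 := _ :&: _; set J2 := _ :&: _.
apply/subv_sumP => i; rewrite !inE => /andP[ia' ic'].
case: (ltnP i a) => ia.
  by apply: subv_trans (addvSl _ _); rewrite (sumv_sup i) // !inE ia.
by apply: subv_trans (addvSr _ _); rewrite (sumv_sup i) // !inE ia' /=; lia.
Qed.

Lemma span_intervalE i j : 0 < i -> j <= n ->
  span_interval e i j = (flagF e j :&: flagG e (n.+1 - i))%VS.
Proof.
move=> i0 jn; rewrite flagFE flagGE cspanI.
have -> : [set s : 'I_n | s < j] :&: [set s : 'I_n | n <= s + (n.+1 - i)]
        = [set s : 'I_n | i.-1 <= s < j].
  by apply/setP => s; rewrite !inE; have := ltn_ord s; lia.
apply: span_cspan => y; rewrite -(nth_eP y (fun s => i.-1 <= s < j)).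
have sz : size (take j e) = j by rewrite size_take_min size_tuple; lia.
split.
  move=> /(nthP 0%R)[s]; rewrite size_drop sz => sj.
  rewrite nth_drop nth_take; last by lia.
  by move=> <-; exists (i.-1 + s); [lia | split=> //; lia].
move=> [s sn [/andP[is_ sj] ->]]; apply/(nthP 0%R); exists (s - i.-1).
  by rewrite size_drop sz; lia.
by rewrite nth_drop nth_take ?subnKC.
Qed.

Lemma rank_cellE k M W : rank_set n k M ->
  rank_cell e M W <->
  in_cell k (flagF e) (rank_word M) (flagG e) (corank_word n M) W.
Proof.
move=> rM; have [sM _ _ _] := rM.
have intE i : i < k -> span_interval e (nth (0, 0) M i).1 (nth (0, 0) M i).2
    = (flagF e (rank_word M i) :&: flagG e (corank_word n M i))%VS.
  by move=> /(rank_set_nth rM)[? ? ?]; apply: span_intervalE.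
split=> [[b [bW]] | [dimW [x Wx xFG]]].
  rewrite all2E => /andP[/eqP szb /allP bM].
  have sb : size b = k by rewrite szb.
  split; first by rewrite -sb -(span_basis bW); apply/eqP/(basis_free bW).
  exists (nth 0%R b) => [|i ik].
    by rewrite /span_of -sb mkseq_nth (span_basis bW).
  have iz : i < size (zip b M) by rewrite size_zip sb sM minnn.
  by rewrite -intE //; have := bM _ (mem_nth (0%R, (0, 0)) iz); rewrite nth_zip.
exists (mkseq x k); split.
  by rewrite basisEdim -/(span_of x k) -Wx subvv size_mkseq dimW leqnn.
rewrite all2E size_mkseq sM eqxx; apply/(all_nthP (0%R, (0, 0))) => i.
rewrite size_zip size_mkseq sM minnn => ik.
by rewrite nth_zip ?size_mkseq //= nth_mkseq // intE // xFG.
Qed.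

End CoordinateFlags.

(** * Rank varieties and projection varieties *)

Section RankVarieties.
Variables (K : fieldType) (n : nat) (V : vectType K) (e : n.-tuple V).
Hypotheses (char0 : [pchar K]%R =i pred0) (he : basis_of fullv e).
Implicit Types (U W : {vspace V}).

(** The conditions on dimensions are closed, which gives one direction.  For the
other, a chain in [W] with the Schubert conditions has a basis [x] adapted to it
and to [G], at position [g].  Since [C i.+1] lies in [F (u i)], this basis shows
that [W] is in the cell of [(u, g)], and the conditions of [v] on the chain say
that [g] dominates [v]. *)
Lemma closure_rank_cell k M W : rank_set n k M ->
  zariski_closure e k (rank_cell e M) W <->
  \dim W = k /\ incident k (flagF e) (rank_word M) (flagG e) (corank_word n M) W.
Proof.
move=> rM; have exF := flagF_exhaustive he; have exG := flagG_exhaustive he.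
have [_ _ Fmono] := exF; have [_ _ Gmono] := exG.
split=> [clW | [dimW incW] Z [Zcl cellZ]].
  have H b c : \dim W = k /\
      below2 (rank_word M) (corank_word n M) k b c
        <= \dim (W :&: (flagF e b :&: flagG e c)).
    set m := below2 _ _ _ _ _; rewrite flagFE flagGE (cspanI he).
    set J := _ :&: _; apply: (clW [set U | \dim U = k /\ m <= \dim (U :&: cspan e J)]%classic).
    split=> [|U /(rank_cellE he U rM) cU]; first exact: zariski_closed_dim_cap.
    split; first exact: cU.1.
    by rewrite -(cspanI he) -flagFE -flagGE; apply: (in_cell_incident Fmono Gmono cU).
  by split=> [|b c]; [exact: (H 0 0).1 | exact: (H b c).2].
have [M' [rM' pM' incr]] := rank_set_sort rM.
set u := rank_word M'; set v := corank_word n M'.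
have [gu gv] := rank_set_words rM'.
have {}incW : incident k (flagF e) u (flagG e) v W.
  by move=> b c; rewrite (below2_seq _ _ rM') (perm_big _ pM') -(below2_seq _ _ rM).
have un i : i < k -> u i <= n by move=> /(gu.1 i)/andP[].
have vn i : i < k -> v i <= n by move=> /(gv.1 i)/andP[].
have [C [chC Ck HC]] := incident_flagged exF exG un vn dimW incW.
have [g [x [Wx xC gC]]] := chain_adapted exG chC.
have umono i j : i < j -> j < k -> u i <= u j.
  elim: j => // j IHj; rewrite ltnS leq_eqVlt => /predU1P[-> | ij] jk.
    exact/ltnW/incr.
  exact: leq_trans (IHj ij (ltnW jk)) (ltnW (incr _ jk)).
apply: (in_cell_limit exF exG (opposite_flags he) (zariski_closed_limit he char0 Zcl)
  umono vn _ (g := g)).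
- move=> U /(rank_cellE he U rM') /(rank_cell_perm pM'); exact: cellZ.
- by move=> i /xC[].
- move=> j jk c; have [_ vj] := HC j jk isT; exact: leq_trans (vj c) (gC j jk c).
split=> //; rewrite -Ck; exists x => // i ik; have [_ xi xG] := xC i ik.
rewrite memv_cap xG andbT; have [ui _] := HC i.+1 ik isT.
apply: subvP xi; have [dimC _] := chC.
rewrite -[X in (X <= _)%VS](_ : (C i.+1 :&: flagF e (u i) = C i.+1)%VS) ?capvSr //.
apply/eqP; rewrite eqEdim capvSl dimC //.
have := ui (u i); rewrite below_all // => j; rewrite ltnS leq_eqVlt.
by case/predU1P=> [-> // | ji]; apply: umono.
Qed.

(** The order by upper ends is what makes the Schubert conditions of a chain
imply the incidence conditions: other orders can give larger varieties. *)
Lemma closure_rank_cell_flagged k M W : rank_set n k M ->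
  (forall i, i.+1 < k -> rank_word M i < rank_word M i.+1) ->
  zariski_closure e k (rank_cell e M) W <->
  flagged predT k (flagF e) (rank_word M) (flagG e) (corank_word n M) W.
Proof.
move=> rM incr; have [gu gv] := rank_set_words rM.
have exF := flagF_exhaustive he; have exG := flagG_exhaustive he.
rewrite (closure_rank_cell W rM); split=> [[dimW] | flW].
  apply: (incident_flagged exF exG) => // i ik; last by have /andP[] := gv.1 i ik.
  by have /andP[] := gu.1 i ik.
by have [_ _ Fmono] := exF; apply: flagged_incident flW.
Qed.

Lemma zariski_closure_perm k M M' : perm_eq M' M ->
  zariski_closure e k (rank_cell e M') = zariski_closure e k (rank_cell e M).
Proof.
move=> pM; congr (zariski_closure e k _); apply/seteqP; split=> W.
  exact: rank_cell_perm.
by apply: rank_cell_perm; rewrite perm_sym.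
Qed.

(** The basis vectors at the upper ends are distinct and lie in the intervals. *)
Lemma rank_cell_nonempty k M : rank_set n k M -> exists W, rank_cell e M W.
Proof.
move=> rM; have [gu _] := rank_set_words rM; have [rng inj] := gu.
pose x i := nth 0%R e (rank_word M i).-1.
exists (span_of x k); apply/(rank_cellE he _ rM); split; last first.
  exists x => // i ik; have [i1 i12 i2] := rank_set_nth rM ik.
  have un : (rank_word M i).-1 < n by rewrite /rank_word; lia.
  rewrite flagFE flagGE (cspanI he); apply/(mem_cspan he) => s.
  rewrite !inE (coord_e he (Ordinal un)); case: eqP => // <-.
  by rewrite /= /rank_word /corank_word; lia.
have sz := size_mkseq x k.
suff : free (Tuple (introT eqP sz)) by rewrite /free /= sz => /eqP.
apply/freeP => a a0 j; have un (i : 'I_k) : (rank_word M i).-1 < n.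
  by have := rng i (ltn_ord i); lia.
have := congr1 (coord e (Ordinal (un j))) a0; rewrite linear0 => <-.
rewrite linear_sum (bigD1 j) //= nth_mkseq // linearZ /=.
rewrite (coord_e he (Ordinal (un j))) eqxx mulr1 big1 ?addr0 // => i ij.
rewrite nth_mkseq // linearZ /= (coord_e he (Ordinal (un i))).
case: eqP => [[eq_u]|]; last by rewrite mulr0.
case/eqP: ij; apply: ord_inj; apply: inj => //.
by have := rng i (ltn_ord i); have := rng j (ltn_ord j); lia.
Qed.

Lemma flagged_eq (L : pred nat) k F u u' G v v' W :
  (forall i, i < k -> u i = u' i) -> (forall i, i < k -> v i = v' i) ->
  @flagged K V L k F u G v W -> flagged L k F u' G v' W.
Proof.
move=> uu' vv' [C [chC Ck HC]]; exists C; split=> // j jk Lj.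
have [uj vj] := HC j jk Lj.
have E w w' b : (forall i, i < k -> w i = w' i) -> below w' j b = below w j b.
  by move=> ww'; apply: eq_below => i ij; rewrite ww' // (leq_trans ij).
by split=> b; rewrite ?(E u u') ?(E v v').
Qed.

Lemma schubert_index_word k ks us : flag_dims k ks -> schubert_index n ks us ->
  good_word n k (nth 0 us).
Proof.
move=> [_ lks] [sus uus rus _]; rewrite lks in sus.
split=> [i ik | i j ik jk /eqP].
  by apply: (allP rus); rewrite mem_nth ?sus.
by rewrite nth_uniq ?sus // => /eqP.
Qed.

Lemma projection_varietyE k ks us vs W : 0 < k -> flag_dims k ks ->
  schubert_index n ks us -> schubert_index n ks vs ->
  (last 0%VS @` richardson e ks us vs)%classic W <->
  flagged (mem ks) k (flagF e) (nth 0 us) (flagG e) (nth 0 vs) W.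
Proof.
move=> k0 fks ius ivs.
exact: (image_flagged W (flagF_exhaustive he) (flagG_exhaustive he)).
Qed.

(** A word pair with a flag comes from intervals: [F (u i)] and [G (v i)] meet,
hence [n < u i + v i]. *)
Lemma projection_rank k (X : set {vspace V}) : 0 < k ->
  projection_variety e k X -> rank_variety e k X.
Proof.
move=> k0 [ks [us [vs [fks ius ivs [fl0 Rfl0] XE]]]].
have exF := flagF_exhaustive he; have exG := flagG_exhaustive he.
have kks : k \in ks.
  have [_ <-] := fks; case: (ks) (fks.2) => [/= k0'|a s _]; first by rewrite -k0' in k0.
  exact: mem_last.
have [u1 [v1 [gu1 gv1 E1]]] := @flagged_blocks _ _ (mem ks) n k (flagF e) _ (flagG e) _
  kks (schubert_index_word fks ius) (schubert_index_word fks ivs).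
have [u [v [gu gv incr E2]]] := flagged_increasing exF exG gu1 gv1.
have XP W : X W <-> flagged predT k (flagF e) u (flagG e) v W.
  rewrite XE; split=> [/(projection_varietyE W k0 fks ius ivs)/E1/E2 //|].
  by move=> /E2/E1/(projection_varietyE W k0 fks ius ivs).
have overlap i : i < k -> n < u i + v i.
  move=> ik; have /XP flW : X (last 0%VS fl0) by rewrite XE; exists fl0.
  have [_ _ Fmono] := exF; have [_ incW] := flagged_incident Fmono incr flW.
  rewrite ltnNge; apply/negP => uvn.
  have := incW (u i) (v i); rewrite (opposite_flags he).1 // capv0 dimv0.
  by rewrite /below2 (bigD1 (Ordinal ik)) //= !leqnn.
pose M := mkseq (fun i => (n.+1 - v i, u i)) k.
have uM i : i < k -> u i = rank_word M i by move=> ik; rewrite /rank_word nth_mkseq.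
have vM i : i < k -> v i = corank_word n M i.
  move=> ik; rewrite /corank_word nth_mkseq //= subKn //.
  by have /andP[_ /leqW] := gv.1 i ik.
have rM : rank_set n k M.
  split; first by rewrite size_mkseq.
  - apply/allP => p /mapP[m]; rewrite mem_iota => /= mk ->.
    by have := overlap m mk; have := gu.1 m mk; have := gv.1 m mk; rewrite /=; lia.
  - rewrite -map_comp map_inj_in_uniq ?iota_uniq // => i j.
    rewrite !mem_iota /= => ik jk eq_ij; apply: (gv.2 _ _ ik jk).
    by have := gv.1 i ik; have := gv.1 j jk; lia.
  rewrite -map_comp map_inj_in_uniq ?iota_uniq // => i j.
  by rewrite !mem_iota /= => ik jk /(gu.2 _ _ ik jk).
have incrM i : i.+1 < k -> rank_word M i < rank_word M i.+1.
  by move=> ik; rewrite -!uM ?incr //; apply: ltnW.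
exists M; split=> //; apply/seteqP; split=> W.
  move=> /XP flW; apply/(closure_rank_cell_flagged W rM incrM).
  exact: flagged_eq flW.
move=> /(closure_rank_cell_flagged W rM incrM) flW; apply/XP.
by apply: flagged_eq flW => i ik; rewrite ?uM ?vM.
Qed.

(** The rank set, listed by increasing upper ends, is used as the pair of words
of a Richardson variety in the flags of dimensions [1, ..., k]. *)
Lemma rank_projection k (X : set {vspace V}) : 0 < k ->
  rank_variety e k X -> projection_variety e k X.
Proof.
move=> k0 [M0 [rM0 XE]].
have [M [rM pM incr]] := rank_set_sort rM0.
have {M0 rM0 pM} XE : X = zariski_closure e k (rank_cell e M).
  by rewrite XE (zariski_closure_perm k pM).
have [gu gv] := rank_set_words rM.
set u := rank_word M; set v := corank_word n M.
have fks : flag_dims k (iota 1 k).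
  split; first exact: (iota_ltn_sorted 0 k.+1).
  by rewrite -nth_last size_iota nth_iota ?prednK // add1n prednK.
have index w : good_word n k w -> schubert_index n (iota 1 k) (mkseq w k).
  move=> [rng inj]; split.
  - by rewrite fks.2 size_mkseq.
  - rewrite map_inj_in_uniq ?iota_uniq // => i j.
    by rewrite !mem_iota /= => ik jk; apply: inj.
  - by apply/allP => a /mapP[m]; rewrite mem_iota => /= mk ->; apply: rng.
  by move=> j; rewrite size_mkseq mem_iota; lia.
have XP W : X W <->
    (last 0%VS @` richardson e (iota 1 k) (mkseq u k) (mkseq v k))%classic W.
  rewrite (projection_varietyE W k0 fks (index _ gu) (index _ gv)).
  rewrite XE (closure_rank_cell_flagged W rM incr); split=> flW.
    apply: (@flagged_sub _ _ predT) => //.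
    by apply: flagged_eq flW => i ik; rewrite nth_mkseq.
  have {flW}[C [chC Ck HC]] : flagged (mem (iota 1 k)) k (flagF e) u (flagG e) v W.
    by apply: flagged_eq flW => i ik; rewrite nth_mkseq.
  exists C; split=> // -[_ _ | j jk _]; first by split=> b; rewrite below0.
  by apply: HC => //; change (j.+1 \in iota 1 k); rewrite mem_iota; lia.
exists (iota 1 k), (mkseq u k), (mkseq v k); split=> //; try exact: index.
  have [W cW] := rank_cell_nonempty rM.
  have /XP[fl Rfl _] : X W by rewrite XE => Z [_ cZ]; apply: cZ.
  by exists fl.
by apply/seteqP; split=> W /XP.
Qed.

End RankVarieties.

Theorem theorem4p5 (R : realType) (n k : nat) (V : vectType R[i])
    (e : n.-tuple V) (he : basis_of fullv e) (hk : (0 < k < n)%N)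
    (X : set {vspace V}) (hX : zariski_closed e k X) :
  projection_variety e k X <-> rank_variety e k X.
Proof.
have k0 : (0 < k)%N by case/andP: hk.
have char0 := pchar_num R[i].
split; first exact: projection_rank.
exact: rank_projection.
Qed.
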